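(* Let $m\ge1$. A vector $\mathbf x\in K_S^m$ is singular if and only if the corresponding trajectory $\{g_tu_{\mathbf x}\mathcal O_K^{m+1}\mid t\ge 0\}$ is divergent in $G/\Gamma$.
   Context: $K$ is a totally real number field of degree $d$ over $\mathbb Q$ with ring of integers $\mathcal O_K$; $S$ is the set of its $d$ archimedean places, identified with the embeddings $\sigma:K\to\mathbb R$. For $\sigma\in S$, $K_\sigma\cong\mathbb R$ is the completion of $\sigma(K)$, and $K_S=\prod_{\sigma\in S}K_\sigma$. $K$ is embedded diagonally in $K_S$ by $\alpha\mapsto(\sigma(\alpha))_{\sigma\in S}$ and identified with its image; similarly $K^m\subset K_S^m\simeq\prod_{\sigma}K_\sigma^m$. For $x=(x^\sigma)\in K_S$, $\|x\|=\max_\sigma|x^\sigma|$; for $\mathbf x=(x_1,\dots,x_m)\in K_S^m$, $\|\mathbf x\|=\max_j\|x_j\|$. For $\mathbf q\in\mathcal O_K^m$, $\mathbf q\cdot\mathbf x=\sum_j q_jx_j\in K_S$. Singular: $\mathbf x\in K_S^m$ is singular if for every $c>0$, for all sufficiently large $Q>0$ there exist $\mathbf 0\ne\mathbf q\in\mathcal O_K^m$ and $q_0\in\mathcal O_K$ with $\|\mathbf q\cdot\mathbf x+q_0\|<c/Q^m$ and $\|\mathbf q\|\le Q$. $G=\mathrm{SL}_{m+1}(K_S)\simeq\prod_{\sigma\in S}\mathrm{SL}_{m+1}(K_\sigma)$ and $\Gamma=\mathrm{SL}_{m+1}(\mathcal O_K)$, a lattice in $G$ via the diagonal embedding. For $\mathbf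 x\in K_S^m$ (viewed as a row vector), $u_{\mathbf x}=\begin{bmatrix}1&\mathbf x\\0&I_m\end{bmatrix}\in G$. For $t\in\mathbb R$, $g_t=(g_t^\sigma)_{\sigma\in S}\in G$ with $g_t^\sigma=\mathrm{diag}(e^{mt},e^{-t},\dots,e^{-t})$ for every $\sigma$. $G/\Gamma$ is identified with the set $\{g\mathcal O_K^{m+1}\mid g\in G\}$ of discrete $\mathcal O_K$-submodules of $K_S^{m+1}$ via $g\Gamma\leftrightarrow g\mathcal O_K^{m+1}$. The trajectory is divergent if it eventually leaves every compact subset of $G/\Gamma$ as $t\to\infty$. *)

(* Defs.v *)
From HB Require Import structures.
From mathcomp Require Import all_boot all_order all_algebra all_field.
From mathcomp Require Import polyrcf complex.
From mathcomp Require Import all_classical all_reals all_analysis.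

Set Implicit Arguments.
Unset Strict Implicit.
Unset Printing Implicit Defensive.

Import Order.TTheory GRing.Theory Num.Theory.
Import numFieldNormedType.Exports.

Local Open Scope classical_set_scope.
Local Open Scope ring_scope.
Local Open Scope complex_scope.

(* [R : realType] is the field of real numbers, so that [R[i]] is the field of
   complex numbers; a number field is a [K : fieldExtType rat]. *)

Definition totally_real (R : realType) (K : fieldExtType rat) : Prop :=
  forall (f : {rmorphism K -> R[i]}) (a : K), f a \is Num.real.

Definition ring_of_integers (K : fieldExtType rat) : set K :=
  [set a | integralOver (intr : int -> K) a].

(* When [K] is totally real, these are all of its archimedean places. *)
Definition place (R : realType) (K : fieldExtType rat) : Type :=
  {rmorphism K -> R}.

(* There are finitely many places: an embedding is determined by the images of
   the elements of a basis, and each of these is a root of a fixed nonzero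
   rational polynomial. *)
Section PlaceFinite.
Variables (R : realType) (K : fieldExtType rat).
Implicit Types f g : {rmorphism K -> R}.

Lemma place_root (a : K) :
  exists2 p : {poly rat}, p != 0 & forall f, root (map_poly ratr p) (f a).
Proof.
have /polyOver1P[p pE] := minPolyOver 1%AS a.
exists p => [|f].
  by apply/eqP => p0; move: (monic_minPoly 1%AS a);
    rewrite pE p0 map_poly0 monicE lead_coef0 eq_sym oner_eq0.
have : root (map_poly f (minPoly 1%AS a)) (f a).
  by rewrite fmorph_root root_minPoly.
rewrite pE -map_poly_comp (_ : map_poly _ p = map_poly ratr p)//.
by apply: eq_map_poly => b /=; rewrite alg_num_field fmorph_rat.
Qed.

Lemma place_ext f g : (f : K -> R) =1 g -> f = g.
Proof.
case: f g => f [[f1] [f2]] [g [[g1] [g2]]] /= /funext fg; subst g.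
by congr (GRing.RMorphism.Pack (GRing.RMorphism.Class _ _));
  [congr (Algebra.isNmodMorphism.Axioms_ _) |
   congr (GRing.isMonoidMorphism.Axioms_ _)]; exact: Prop_irrelevance.
Qed.

Let n := \dim {:K}.
Let b : n.-tuple K := vbasis {:K}.

Lemma place_basis_inj f g : (forall i : 'I_n, f b`_i = g b`_i) -> f = g.
Proof.
move=> fg; apply: place_ext => a.
rewrite (coord_vbasis (memvf a)) !rmorph_sum; apply: eq_bigr => i _.
by rewrite -mulr_algl !rmorphM /= alg_num_field !fmorph_rat fg.
Qed.

Let pol (a : K) : {poly rat} := s2val (cid2 (place_root a)).

Let roots : seq R :=
  flatten [seq rootsR (map_poly ratr (pol b`_i)) | i <- iota 0 n].

Lemma place_in_roots f (i : 'I_n) : f b`_i \in roots.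
Proof.
apply/flatten_mapP; exists (i : nat); first by rewrite mem_iota /=.
rewrite /pol; case: cid2 => p /= p0 /(_ f) fp.
by rewrite -roots_on_rootsR ?map_poly_eq0// in_itv/=.
Qed.

Let code f : {ffun 'I_n -> seq_sub roots} :=
  [ffun i => SeqSub (place_in_roots f i)].

Let decode (c : {ffun 'I_n -> seq_sub roots}) : option (place R K) :=
  match pselect (exists f, code f = c) with
  | left h => Some (sval (cid h))
  | right _ => None
  end.

Lemma place_codeK : pcancel code decode.
Proof.
move=> f; rewrite /decode; case: pselect => [h|[]]; last by exists f.
congr Some; case: cid => g /= /ffunP gf.
by apply: place_basis_inj => i; have := gf i; rewrite !ffunE => -[].
Qed.

HB.instance Definition _ := Finite.copy (place R K) (pcan_type place_codeK).

End PlaceFinite.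

(* K_S, with the product ring structure and the product topology *)
Definition KS (R : realType) (K : fieldExtType rat) : Type := place R K -> R.

HB.instance Definition _ (R : realType) (K : fieldExtType rat) :=
  GRing.ComPzRing.copy (KS R K) (place R K -> R).
HB.instance Definition _ (R : realType) (K : fieldExtType rat) :=
  Uniform.copy (KS R K) {ptws place R K -> R}.

Section Definitions.
Local Open Scope quotient_scope.
Variables (R : realType) (K : fieldExtType rat).
Local Notation KS := (KS R K).
Local Notation OK := (@ring_of_integers K).

Definition diag_emb (a : K) : KS := fun s => s a.

Let diag_emb_zmod : zmod_morphism diag_emb.
Proof. by move=> a b; apply/funext => s; rewrite [LHS]rmorphB. Qed.

Let diag_emb_monoid : monoid_morphism diag_emb.
Proof.
by split=> [|a b]; apply/funext => s; rewrite [LHS](rmorph1, rmorphM).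
Qed.

HB.instance Definition _ :=
  GRing.isZmodMorphism.Build K KS diag_emb diag_emb_zmod.
HB.instance Definition _ :=
  GRing.isMonoidMorphism.Build K KS diag_emb diag_emb_monoid.

Definition norm_KS (a : KS) : R := \big[Num.max/0]_(s : place R K) `|a s|.

Definition norm_KSm (m : nat) (x : 'rV[KS]_m) : R :=
  \big[Num.max/0]_(j < m) norm_KS (x 0 j).

Definition singular (m : nat) (x : 'rV[KS]_m) : Prop :=
  forall c : R, 0 < c -> \forall Q \near +oo,
    exists (q : 'rV[K]_m) (q0 : K),
      [/\ q != 0,
          (forall j, OK (q 0 j)) /\ OK q0,
          norm_KS (\sum_j diag_emb (q 0 j) * x 0 j + diag_emb q0) < c / Q ^+ m
        & norm_KSm (map_mx diag_emb q) <= Q].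

Definition SL_KS (n : nat) : set 'M[KS]_n := [set g : 'M[KS]_n | \det g = 1].

Definition SL_OK (n : nat) : set 'M[K]_n :=
  [set g : 'M[K]_n | (forall i j, OK (g i j)) /\ \det g = 1].

Arguments SL_KS n : clear implicits.
Arguments SL_OK n : clear implicits.

Definition left_coset (n : nat) (g : 'M[KS]_n) : set 'M[KS]_n :=
  [set g *m map_mx diag_emb gamma | gamma in SL_OK n].

Definition lattice (n : nat) (g : 'M[KS]_n) : set 'cV[KS]_n :=
  [set g *m map_mx diag_emb v | v in [set v : 'cV[K]_n | forall i, OK (v i 0)]].

Let intrK : {rmorphism int -> K} := intr.

Let OK0 : OK 0. Proof. exact: (mxpoly.integral0 intrK). Qed.

Let OK1 : OK 1. Proof. exact: (integral1 intrK). Qed.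

Lemma integral_mulmx (p q r : nat) (A : 'M[K]_(p, q)) (B : 'M[K]_(q, r)) :
  (forall i j, OK (A i j)) -> (forall i j, OK (B i j)) ->
  forall i j, OK ((A *m B) i j).
Proof.
move=> OA OB i j; rewrite mxE; elim/big_ind: _ => [|a b Oa Ob|k _]; first exact: OK0.
  exact: (@integral_add _ _ intrK).
by apply: (@integral_mul _ _ intrK); [exact: OA|exact: OB].
Qed.

(* g Gamma <-> g O_K^n is a bijection from G / Gamma to the set of lattices *)
Lemma lattice_coset (n : nat) (g h : 'M[KS]_n) :
  \det g = 1 -> \det h = 1 ->
  lattice g = lattice h <-> left_coset g = left_coset h.
Proof.
move=> g1 h1; split; last first.
  have sub (k l : 'M[KS]_n) :
      left_coset k = left_coset l -> lattice l `<=` lattice k.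
    move=> kl; have /= : left_coset k l.
      rewrite kl; exists 1%:M; last by rewrite map_mx1 mulmx1.
      split; last exact: det1.
      by move=> i j; rewrite mxE; case: eqP => _; [exact: OK1|exact: OK0].
    move=> [gam [Ogam _] <-] _ [v Ov <-].
    exists (gam *m v); last by rewrite map_mxM mulmxA.
    by move=> i; apply: integral_mulmx => // i' j; rewrite ord1.
  by move=> gh; apply/seteqP; split; apply: sub.
have sub (k l : 'M[KS]_n) : \det k = 1 -> \det l = 1 ->
    lattice k = lattice l -> left_coset l `<=` left_coset k.
  move=> k1 l1 kl.
  have /choice[v vP] (j : 'I_n) : exists v : 'cV[K]_n,
      (forall i, OK (v i 0)) /\ k *m map_mx diag_emb v = col j l.
    suff [v Ov kv] : lattice k (col j l) by exists v.
    rewrite kl; exists (delta_mx j 0); last first.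
      by rewrite map_delta_mx -colE.
    by move=> i; rewrite mxE; case: (_ && _); [exact: OK1|exact: OK0].
  pose gam : 'M[K]_n := \matrix_(i, j) v j i 0.
  have lE : l = k *m map_mx diag_emb gam.
    apply/matrixP => i j; have [_ /matrixP/(_ i 0)] := vP j.
    by rewrite !mxE => <-; apply: eq_bigr => a _; rewrite !mxE.
  have Ogam i j : OK (gam i j) by rewrite mxE; case: (vP j).
  have [[s]|noplace] := pselect (inhabited (place R K)); last first.
    have eqM (A B : 'M[KS]_n) : A = B.
      apply/matrixP => i j; apply/funext => s.
      by exfalso; apply: noplace; exists.
    by rewrite (eqM l k).
  have gam1 : \det gam = 1.
    have := l1; rewrite lE det_mulmx k1 mul1r det_map_mx.
    move/(congr1 (fun a : KS => a s)) => /= sgam.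
    by apply: (fmorph_inj s); rewrite rmorph1.
  move=> _ [del [Odel del1] <-]; exists (gam *m del).
    split; first exact: integral_mulmx.
    by rewrite det_mulmx gam1 del1 mulr1.
  by rewrite map_mxM mulmxA -lE.
by move=> gh; apply/seteqP; split; apply: sub.
Qed.

Definition same_coset (n : nat) : rel (SL_KS n) :=
  fun g h => `[< left_coset (val g) = left_coset (val h) >].

Lemma same_coset_refl n : reflexive (@same_coset n).
Proof. by move=> g; apply/asboolP. Qed.

Lemma same_coset_sym n : symmetric (@same_coset n).
Proof. by move=> g h; apply/asboolP/asboolP. Qed.

Lemma same_coset_trans n : transitive (@same_coset n).
Proof. by move=> h g k /asboolP gh /asboolP hk; apply/asboolP; rewrite gh. Qed.

Canonical same_coset_equiv n := EquivRel (@same_coset n)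
  (@same_coset_refl n) (@same_coset_sym n) (@same_coset_trans n).

(* G / Gamma, with the quotient of the topology induced on G by the topology of
   the space of matrices *)
Definition homogeneous_space (n : nat) : topologicalType :=
  quotient_topology {eq_quot (same_coset_equiv n)}.

Definition u_mx (m : nat) (x : 'rV[KS]_m) : 'M[KS]_(1 + m) :=
  block_mx 1%:M x 0 1%:M.

Definition g_mx (m : nat) (t : R) : 'M[KS]_(1 + m) :=
  block_mx ((fun=> expR (m%:R * t)) : KS)%:M 0
           0 ((fun=> expR (- t)) : KS)%:M.

Lemma gu_SL (m : nat) (x : 'rV[KS]_m) (t : R) : SL_KS (1 + m) (g_mx m t *m u_mx x).
Proof.
rewrite /SL_KS /= det_mulmx !det_ublock !det1 !det_scalar !mulr1 expr1.
have -> k : ((fun=> expR (- t)) : KS) ^+ k = fun=> expR (- t) ^+ k.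
  by elim: k => [|k IH]; rewrite ?expr0// exprS IH; apply/funext => s;
    rewrite exprS.
apply/funext => s; rewrite [LHS]/GRing.mul /= -expRM_natl -expRD.
by rewrite mulrN subrr expR0.
Qed.

(* The point of G / Gamma corresponding to the lattice g_t u_x O_K^(m+1), see
   [lattice_coset]. *)
Definition trajectory (m : nat) (x : 'rV[KS]_m) (t : R) :
    homogeneous_space (1 + m) :=
  \pi_(homogeneous_space (1 + m))
    (exist _ (g_mx m t *m u_mx x) (mem_set (gu_SL x t)) : SL_KS (1 + m)).

Definition divergent (T : topologicalType) (p : R -> T) : Prop :=
  forall C : set T, compact C -> \forall t \near +oo, ~ C (p t).

End Definitions.

Arguments SL_KS R K n : clear implicits.
Arguments SL_OK K n : clear implicits.

(* Main.v *)
(* Write E = e^t, so that g_t u_x sends (q0, q) to (E^m (q . x + q0), E^-1 q).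
   Singularity of x says that, for every eta > 0, this lattice has a nonzero
   vector shorter than eta for all large t.

   Short vectors force divergence because having all nonzero vectors longer than
   eta is an open condition on G / Gamma, satisfied near each point for some
   eta > 0: nonzero algebraic integers have absolute value at least 1 at some
   place, since their norm is a nonzero integer.

   For the converse, only the case of Mahler's criterion along the trajectory is
   needed.  Dirichlet's pigeonhole argument shows that among J points of
   K_S^(m+1), with J independent of t, two are eps-close modulo the lattice
   unless there is a nonzero lattice vector shorter than eps.  Applied to the
   multiples 0, e_i, ..., (J - 1) e_i of each basis vector it produces lattice
   vectors within eps of k_i e_i with 1 <= |k_i| < J, that is, a matrix w over
   O_K with g_t u_x w diagonally dominant and bounded.  As \det w is bounded and
   there are finitely many cosets SL(O_K) w for each value of \det w, some
   g_t u_x gamma with gamma in SL(O_K) is bounded as well. *)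

From HB Require Import structures.
Require Import Defs.
From mathcomp Require Import all_boot all_order perm all_algebra all_field.
From mathcomp Require Import complex lra ring.
From mathcomp Require Import all_classical all_reals all_analysis.

Set Implicit Arguments.
Unset Strict Implicit.
Unset Printing Implicit Defensive.

Import Order.TTheory GRing.Theory Num.Theory.
Import numFieldNormedType.Exports.

Local Open Scope classical_set_scope.
Local Open Scope ring_scope.

(** * Embeddings and integral bases *)

Lemma primitive_element_rat (K : fieldExtType rat) :
  exists z : K, <<1; z>>%VS = fullv.
Proof.
exists (separable_generator 1 {:K}).
rewrite -(@eq_adjoin_separable_generator _ _ {:K}%AS 1%AS) ?sub1v//.
apply/separableP => y _; apply: pcharf0_separable => p.
by rewrite pchar_lalg pchar_num.
Qed.

Lemma intr_eq0_numfield (K : fieldExtType rat) (k : int) :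
  (k%:~R == 0 :> K) = (k == 0).
Proof. by rewrite -(rmorph_int (in_alg K)) fmorph_eq0 intr_eq0. Qed.

Lemma integral_multiple (K : fieldExtType rat) (a : K) :
  exists2 l : int, l != 0 & ring_of_integers (l%:~R * a).
Proof.
have /polyOver1P[p pE] := minPolyOver 1%AS a.
have [q [k k0 pq]] := rat_poly_scale p.
have p0 : p != 0.
  by apply/eqP => p0; move: (monic_minPoly 1%AS a);
    rewrite pE p0 map_poly0 monicE lead_coef0 eq_sym oner_eq0.
have q0 : q != 0 by apply: contraNneq p0 => q0; rewrite pq q0 map_poly0 scaler0.
have qa : (map_poly intr q).[a] = 0 :> K.
  have := root_minPoly 1%AS a; rewrite pE pq => /rootP.
  rewrite map_polyZ /= hornerZ -map_poly_comp.
  rewrite (_ : map_poly _ q = map_poly intr q); last first.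
    by apply: eq_map_poly => j /=; rewrite scaler_int.
  by move/eqP; rewrite mulf_eq0 scaler_eq0 oner_eq0 orbF invr_eq0 intr_eq0 (negbTE k0) => /eqP.
exists (lead_coef q); first by rewrite lead_coef_eq0.
set l := lead_coef q.
have sq : (0 < size q)%N by rewrite size_poly_gt0.
set n := (size q).-1.
have n0 : (0 < n)%N.
  rewrite lt0n; apply: contra_eq_neq qa => n0.
  have /size_poly1P[c c0 ->] : size q == 1 by rewrite -(prednK sq) -/n n0.
  by rewrite map_polyC hornerC intr_eq0_numfield.
(* Multiplying [q(a) = 0] by [l ^+ n.-1] makes the equation monic in [l * a]: this [r] satisfies
   [r(l X) = l^(n-1) q(X)]. The truncated exponent at [i = n] is bypassed by the test. *)
pose r : {poly K} := \poly_(i < n.+1) (if i == n then 1 else (q`_i)%:~R * l%:~R ^+ (n.-1 - i)).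
have rn : r`_n = 1 by rewrite coef_poly ltnSn eqxx.
have sr : size r = n.+1 by rewrite size_poly_eq// eqxx oner_eq0.
have lK (j : int) : integralOver (intr : {rmorphism int -> K}) j%:~R := integral_id _ j.
apply: (@integral_root_monic _ _ (intr : {rmorphism int -> K}) _ r).
- by rewrite monicE lead_coefE sr rn.
- have sz : (size (map_poly intr q : {poly K}) <= n.+1)%N by rewrite prednK// size_poly.
  move: qa; rewrite (horner_coef_wide _ sz) => /(congr1 ( *%R (l%:~R ^+ n.-1))).
  rewrite mulr0 mulr_sumr rootE horner_poly => qa'; apply/eqP; rewrite -[RHS]qa'.
  apply: eq_bigr => i _.
  rewrite coef_map exprMn; case: eqP => [->|/eqP ni].
    rewrite -/(lead_coef q) -/l mul1r !mulrA; congr (_ * _).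
    by rewrite -exprSr prednK.
  rewrite mulrA -(mulrA (q`_i)%:~R) -exprD subnK; first by rewrite mulrCA mulrA.
  by rewrite -ltnS prednK// ltn_neqAle ni -ltnS ltn_ord.
- apply/integral_poly => i; rewrite coef_poly; case: ifP => _; last exact: mxpoly.integral0.
  case: ifP => _; first exact: integral1.
  apply: integral_mul => //; elim: (_ - _)%N => [|j ih]; first exact: integral1.
  by rewrite exprS; apply: integral_mul.
Qed.

(** Every element of [K] is the value at [a] of a rational polynomial. Evaluating that polynomial at
    [z] instead does not depend on its choice, because [p] divides every polynomial vanishing at
    [a]. *)
Lemma embedding_extension (C : numFieldType) (K : fieldExtType rat) (a : K)
    (p : {poly rat}) (z : C) :
  <<1; a>>%VS = fullv -> minPoly 1 a = map_poly (in_alg K) p ->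
  root (map_poly ratr p) z -> exists f : {rmorphism K -> C}, f a = z.
Proof.
move=> aK pE pz.
have /choice[P PE] (x : K) : exists q : {poly rat}, x = (map_poly (in_alg K) q).[a].
  have : x \in <<1; a>>%VS by rewrite aK memvf.
  by move=> /Fadjoin_polyP[_ /polyOver1P[q ->] ->]; exists q.
pose ev (q : {poly rat}) := (map_poly ratr q).[z].
have ev0 q : (map_poly (in_alg K) q).[a] = 0 -> ev q = 0.
  move=> qa; suff : p %| q.
    rewrite -(dvdp_map (ratr : {rmorphism rat -> C})) => /dvdpP[r].
    by move/(congr1 (horner^~ z)); rewrite hornerM (rootP pz) mulr0.
  rewrite -(dvdp_map (in_alg K)) -pE minPoly_dvdp//; last exact/rootP.
  by apply/polyOver1P; exists q.
have evE q r : (map_poly (in_alg K) q).[a] = (map_poly (in_alg K) r).[a] -> ev q = ev r.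
  move=> qr; apply/eqP; rewrite -subr_eq0 /ev -hornerN -hornerD -rmorphB; apply/eqP/ev0.
  by rewrite rmorphB hornerD hornerN qr subrr.
pose f x := ev (P x).
have fB : zmod_morphism f.
  move=> x y; rewrite /f (evE _ (P x - P y)); last by rewrite -PE rmorphB hornerD hornerN -!PE.
  by rewrite /ev rmorphB hornerD hornerN.
have fM : monoid_morphism f.
  split=> [|x y].
    by rewrite /f (evE _ 1); [rewrite /ev rmorph1 hornerC|rewrite -PE rmorph1 hornerC].
  rewrite /f (evE _ (P x * P y)); last by rewrite -PE rmorphM hornerM -!PE.
  by rewrite /ev rmorphM hornerM.
pose F : {rmorphism K -> C} := HB.pack f
  (GRing.isZmodMorphism.Build K C f fB) (GRing.isMonoidMorphism.Build K C f fM).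
exists F; rewrite /= /f (evE _ 'X); first by rewrite /ev map_polyX hornerX.
by rewrite -PE map_polyX hornerX.
Qed.
Lemma real_place (R : realType) (K : fieldExtType rat) (f : {rmorphism K -> R[i]}) :
  (forall a, f a \is Num.real) -> exists s : place R K, forall a, f a = (s a)%:C%C.
Proof.
move=> fR; pose g a := complex.Re (f a).
have fE a : f a = (g a)%:C%C by rewrite /g RRe_real.
have CI : injective (fun r : R => r%:C%C) by move=> r s [].
have gB : zmod_morphism g.
  by move=> a b; apply: CI => /=; rewrite -fE !rmorphB /= !fE.
have gM : monoid_morphism g.
  split=> [|a b]; apply: CI => /=; first by rewrite -fE !rmorph1.
  by rewrite -fE !rmorphM /= !fE.
pose G : {rmorphism K -> R} := HB.pack g
  (GRing.isZmodMorphism.Build K R g gB) (GRing.isMonoidMorphism.Build K R g gM).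
by exists G.
Qed.

(** Indexing the family by the number of places makes the matrix square; by [card_place] this number
    is the degree of a totally real [K]. *)
Definition place_mx (R : realType) (K : fieldExtType rat)
    (b : 'I_#|{: place R K}| -> K) : 'M[R]_#|{: place R K}| :=
  \matrix_(j, i) (enum_val i : place R K) (b j).

(** The family need not generate O_K over the integers: it only serves to round with bounded error.
    Invertibility of [place_mx b] makes it a basis of K_S over the reals as well. *)
Definition integral_basis (R : realType) (K : fieldExtType rat)
    (b : 'I_#|{: place R K}| -> K) : Prop :=
  [/\ forall j, ring_of_integers (b j),
      forall a, exists c : 'I_#|{: place R K}| -> rat, a = \sum_j c j *: b j
    & place_mx b \in unitmx].

(** A place is determined by the image of [a], a root of the minimal polynomial, which bounds the
    number of places from above. Conversely, that polynomial has distinct complex roots by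
    separability, each root extends to a complex embedding, and this embedding is real by
    hypothesis. *)
Lemma card_place (R : realType) (K : fieldExtType rat) (a : K) :
  totally_real R K -> <<1; a>>%VS = fullv ->
  #|{: place R K}| = adjoin_degree 1 a /\ injective (fun s : place R K => s a).
Proof.
move=> hK aK.
have /polyOver1P[p pE] := minPolyOver 1%AS a.
have p0 : p != 0.
  by apply/eqP => p0; move: (monic_minPoly 1%AS a);
    rewrite pE p0 map_poly0 monicE lead_coef0 eq_sym oner_eq0.
have sp : size p = (adjoin_degree 1 a).+1 by rewrite -size_minPoly pE size_map_poly.
have inj : injective (fun s : place R K => s a).
  move=> s t st; apply: place_ext => y; have : y \in <<1; a>>%VS by rewrite aK memvf.
  move=> /Fadjoin_polyP[_ /polyOver1P[q ->] ->].
  rewrite -!horner_map /= st; congr (_.[_]); rewrite -!map_poly_comp.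
  by apply: eq_map_poly => b /=; rewrite alg_num_field !fmorph_rat.
split=> //; apply/eqP; rewrite eqn_leq; apply/andP; split.
  rewrite -ltnS -sp -(size_map_poly (ratr : {rmorphism rat -> R})) cardE.
  rewrite -(size_map (fun s : place R K => s a)); apply: max_poly_roots.
  - by rewrite map_poly_eq0.
  - apply/allP => _ /mapP[s _ ->]; have : root (map_poly s (minPoly 1%AS a)) (s a).
      by rewrite fmorph_root root_minPoly.
    rewrite pE -map_poly_comp (_ : map_poly _ p = map_poly ratr p)//.
    by apply: eq_map_poly => b /=; rewrite alg_num_field fmorph_rat.
  - by rewrite map_inj_uniq ?enum_uniq.
have [r rE] := closed_field_poly_normal (map_poly (ratr : {rmorphism rat -> R[i]}) p).
have lp : lead_coef p = 1.
  have := monic_minPoly 1%AS a; rewrite pE monicE lead_coef_map.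
  by rewrite -(rmorph1 (in_alg K)) => /eqP/(fmorph_inj (in_alg K)).
rewrite lead_coef_map lp rmorph1 scale1r in rE.
have ur : uniq r.
  rewrite -separable_prod_XsubC -rE separable_map -(separable_map (in_alg K)) -pE.
  have : separable_element 1 a by apply: pcharf0_separable => q; rewrite pchar_lalg pchar_num.
  by [].
have sr : size r = adjoin_degree 1 a.
  by apply: succn_inj; rewrite -sp -(size_map_poly (ratr : {rmorphism rat -> R[i]})) rE size_prod_XsubC.
rewrite -sr cardE -(size_map (fun s : place R K => (s a)%:C%C)).
apply: uniq_leq_size => // z zr.
have [|f fz] := @embedding_extension R[i] K a p z aK pE.
  by rewrite rE root_prod_XsubC.
have [s sE] := real_place (hK f).
by apply/mapP; exists s; rewrite ?mem_enum// -sE fz.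
Qed.

(** The powers of an integral primitive element work: their place matrix is a Vandermonde matrix in
    distinct conjugates. *)
Lemma integral_basis_exists (R : realType) (K : fieldExtType rat) :
  totally_real R K -> exists b : 'I_#|{: place R K}| -> K, integral_basis b.
Proof.
move=> hK; have [a' a'K] := primitive_element_rat K.
have [l l0 la] := integral_multiple a'; set a := l%:~R * a' in la.
have aK : <<1; a>>%VS = fullv.
  apply/eqP; rewrite eqEsubv subvf -a'K; apply/FadjoinP; split; first exact: sub1v.
  have -> : a' = (l%:~R^-1 : rat) *: a.
    by rewrite /a -scaler_int -scalerAl mul1r scalerA mulVf ?scale1r// intr_eq0.
  by apply/memvZ/memv_adjoin.
have [card inj] := card_place hK aK.
exists (fun j => a ^+ j); split.
- move=> j; elim: (nat_of_ord j) => [|k ih]; first exact: (integral1 (intr : {rmorphism int -> K})).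
  by rewrite exprS; apply: (@integral_mul _ _ (intr : {rmorphism int -> K})).
- move=> y; have : y \in <<1; a>>%VS by rewrite aK memvf.
  move=> /Fadjoin_poly_eq <-; have := size_Fadjoin_poly 1 a y.
  have /polyOver1P[q ->] := Fadjoin_polyOver 1 a y.
  rewrite -card => /horner_coef_wide ->; exists (fun j => q`_j).
  by apply: eq_bigr => j _; rewrite coef_map mulr_algl.
- rewrite unitmxE (_ : place_mx _ = Vandermonde _ (\row_i (enum_val i : place R K) a)); last first.
    by apply/matrixP => j i; rewrite !mxE rmorphXn.
  rewrite det_Vandermonde unitfE prodf_seq_neq0; apply/allP => i _ /=.
  rewrite prodf_seq_neq0; apply/allP => j _; apply/implyP => ij.
  rewrite !mxE subr_eq0; apply: contraTneq ij => /inj/enum_val_inj ->.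
  by rewrite ltnn.
Qed.
(** * Algebraic integers *)

(** A boolean predicate, so that O_K can be declared a subring and the [rpred] lemmas apply. *)
Definition Oint (K : fieldExtType rat) : {pred K} := fun a => `[< ring_of_integers a >].
Lemma OintP (K : fieldExtType rat) (a : K) : reflect (ring_of_integers a) (a \in @Oint K).
Proof. exact: asboolP. Qed.
Lemma Oint_subring (K : fieldExtType rat) : subring_closed (@Oint K).
Proof.
split=> [|a b /OintP ? /OintP ?|a b /OintP ? /OintP ?]; apply/OintP.
- exact: (integral1 (intr : {rmorphism int -> K})).
- exact: (@integral_sub _ _ (intr : {rmorphism int -> K})).
- exact: (@integral_mul _ _ (intr : {rmorphism int -> K})).
Qed.
HB.instance Definition _ (K : fieldExtType rat) :=
  GRing.isSubringClosed.Build K (@Oint K) (@Oint_subring K).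

Lemma Oint_det (K : fieldExtType rat) n (A : 'M[K]_n) :
  (forall i j, A i j \in @Oint K) -> \det A \in @Oint K.
Proof.
move=> OA; apply: rpred_sum => s _; apply: rpredM.
  by rewrite rpredX// rpredN rpred1.
by apply: rpred_prod.
Qed.

Lemma Oint_adj (K : fieldExtType rat) n (A : 'M[K]_n) :
  (forall i j, A i j \in @Oint K) -> forall i j, \adj A i j \in @Oint K.
Proof.
move=> OA i j; rewrite mxE /cofactor; apply: rpredM.
  by rewrite rpredX// rpredN rpred1.
by apply: Oint_det => k l; rewrite !mxE.
Qed.

Lemma Oint_mulmx (K : fieldExtType rat) p n q (A : 'M[K]_(p, n)) (B : 'M[K]_(n, q)) :
  (forall i j, A i j \in @Oint K) -> (forall i j, B i j \in @Oint K) ->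
  forall i j, (A *m B) i j \in @Oint K.
Proof. by move=> OA OB i j; rewrite mxE rpred_sum// => k _; rewrite rpredM. Qed.

(** The monic integer equation is transported to [algC], where rational algebraic integers are known
    to be integers. *)
Lemma rat_integral_int (R : numFieldType) (q : rat) :
  integralOver (intr : int -> R) (ratr q) -> exists k : int, q = k%:~R.
Proof.
move=> [p pm pq]; have : (ratr q : algC) \in Num.int.
  apply: Cint_rat_Aint; first exact: Crat_rat.
  apply: (@root_monic_Aint (map_poly intr p)).
  - have : root (map_poly (ratr : {rmorphism rat -> R}) (map_poly intr p)) (ratr q).
      rewrite -map_poly_comp (_ : map_poly _ p = map_poly intr p)//.
      by apply: eq_map_poly => k /=; rewrite ratr_int.
    rewrite fmorph_root -(fmorph_root (ratr : {rmorphism rat -> algC})) -map_poly_comp.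
    by rewrite (_ : map_poly _ p = map_poly intr p)//; apply: eq_map_poly => k /=; rewrite ratr_int.
  - exact: monic_map.
  - by apply/polyOverP => i; rewrite coef_map /= rpred_int.
by move=> /intrP[k]; rewrite -(ratr_int algC);
  move=> /(fmorph_inj (ratr : {rmorphism rat -> algC})) ->; exists k.
Qed.

(** Multiplication by [a] has a rational matrix [A] in the basis [b], which [place_mx b]
    diagonalizes with entries [s a]. The product of the [s a] is thus rational, integral and
    nonzero, so its absolute value is at least 1. *)
Lemma integral_place_ge1 (R : realType) (K : fieldExtType rat) (a : K) :
  totally_real R K -> a \in @Oint K -> a != 0 ->
  exists s : place R K, 1 <= `|s a|.
Proof.
move=> hK aO a0; have [b [bO bspan bV]] := integral_basis_exists hK.
pose d := #|{: place R K}|; pose e (i : 'I_d) : place R K := enum_val i.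
have /choice[M ME] (j : 'I_d) := bspan (b j * a).
pose A : 'M[rat]_d := \matrix_(j, k) M j k.
have AV : map_mx ratr A *m place_mx b = place_mx b *m diag_mx (\row_i e i a).
  apply/matrixP => j i; rewrite mul_mx_diag !mxE -rmorphM ME rmorph_sum.
  apply: eq_bigr => k _; rewrite !mxE -mulr_algl rmorphM /=.
  by rewrite alg_num_field fmorph_rat.
have detA : ratr (\det A) = \prod_i e i a.
  apply: (mulIf (_ : \det (place_mx b) != 0)); first by rewrite -unitfE -unitmxE.
  rewrite -[ratr _](det_map_mx (ratr : {rmorphism rat -> R})) -det_mulmx AV.
  by rewrite det_mulmx det_diag mulrC; congr (_ * _); apply: eq_bigr => i _; rewrite mxE.
have [k kE] : exists k : int, \det A = k%:~R.
  apply: (@rat_integral_int R); rewrite detA.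
  apply: (big_ind (integralOver (intr : int -> R))) => [|x y|i _].
  - exact: (integral1 (intr : {rmorphism int -> R})).
  - exact: (@integral_mul _ _ (intr : {rmorphism int -> R})).
  - have /OintP/(integral_rmorph (e i))[p pm pr] := aO.
    exists p => //; rewrite (_ : map_poly intr p = map_poly (e i \o intr) p)//.
    by apply: eq_map_poly => j /=; rewrite rmorph_int.
apply: contrapT => /forallNP small.
have : 1 <= `|\prod_i e i a|.
  rewrite -detA kE ratr_int -intr_norm ler1z -gtz0_ge1 normr_gt0.
  apply: contraNneq a0 => k0; move: detA; rewrite kE k0 rmorph0 => /esym/eqP.
  by move=> /prodf_eq0[i _]; rewrite fmorph_eq0.
(* An empty product would equal 1, so one factor is needed to get strictly below 1; with no place,
   [b] would span only 0. *)
have d0 : (0 < d)%N.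
  rewrite lt0n; apply: contraNneq a0 => d0; have [c ->] := bspan a.
  by rewrite big1// => -[i id]; exfalso; move: id; rewrite -/d d0.
apply/negP; rewrite -ltNge normr_prod.
have le1 i : `|e i a| < 1 by rewrite ltNge; apply/negP/small.
rewrite (bigD1 (Ordinal d0))//=; apply: le_lt_trans (le1 (Ordinal d0)).
rewrite ler_piMr//; apply: prodr_ile1 => i _; rewrite normr_ge0/=.
exact: ltW.
Qed.

(** * Rounding, remainders and boxes in O_K *)

Definition basis_size (R : realType) (K : fieldExtType rat)
    (b : 'I_#|{: place R K}| -> K) : R :=
  \sum_j \sum_(s : place R K) `|s (b j)|.

Lemma basis_size_ge0 (R : realType) (K : fieldExtType rat)
    (b : 'I_#|{: place R K}| -> K) : 0 <= basis_size b.
Proof. by apply: sumr_ge0 => j _; apply: sumr_ge0. Qed.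

Lemma ler_basis_size (R : realType) (K : fieldExtType rat)
    (b : 'I_#|{: place R K}| -> K) (c : 'I_#|{: place R K}| -> R) (T : R)
    (s : place R K) :
  (forall j, `|c j| <= T) -> `|\sum_j c j * s (b j)| <= T * basis_size b.
Proof.
move=> cT; apply: le_trans (ler_norm_sum _ _ _) _.
rewrite mulr_sumr; apply: ler_sum => j _; rewrite normrM ler_pM//.
by rewrite (bigD1 s)//= lerDl sumr_ge0.
Qed.

Lemma floor_sub_norm (R : archiRealDomainType) (x : R) : `|x - (Num.floor x)%:~R| <= 1.
Proof.
rewrite ger0_norm ?subr_ge0 ?floor_le// lerBlDl ltW//.
by rewrite -intrD1 floorD1_gt.
Qed.

Section IntegralBasis.
Variables (R : realType) (K : fieldExtType rat) (b : 'I_#|{: place R K}| -> K).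
Hypothesis hb : integral_basis b.

Lemma Oint_basis j : b j \in @Oint K.
Proof. by case: hb => bO _ _; apply/OintP. Qed.

(** O_K is cobounded in K_S: the real coordinates of [y] in the basis [b] are rounded down. *)
Lemma basis_round (y : place R K -> R) :
  exists2 a : K, a \in @Oint K & forall s, `|y s + s a| <= basis_size b.
Proof.
case: hb => _ _ bV.
pose c := (\row_i y (enum_val i)) *m invmx (place_mx b).
exists (- \sum_j (Num.floor (c 0 j))%:~R * b j) => [|s].
  by rewrite rpredN rpred_sum// => j _; rewrite rpredM ?rpred_int ?Oint_basis.
have -> : y s = \sum_j c 0 j * s (b j).
  have := mulmxKV bV (\row_i y (enum_val i)) => /matrixP/(_ 0 (enum_rank s)).
  rewrite !mxE enum_rankK => <-; apply: eq_bigr => j _.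
  by rewrite [in X in _ * X]mxE enum_rankK.
rewrite rmorphN rmorph_sum /= -sumrB.
rewrite (eq_bigr (fun j => (c 0 j - (Num.floor (c 0 j))%:~R) * s (b j))).
  by rewrite -[leRHS]mul1r; apply: ler_basis_size => j; apply: floor_sub_norm.
by move=> j _; rewrite rmorphM rmorph_int mulrBl.
Qed.

(** Division with remainder: rounding the rational coordinates of [a / m] gives the quotient, and
    the remainder is [m] times a combination of [b] with coefficients in [0, 1). *)
Lemma basis_residue (a m : K) : a \in @Oint K -> m \in @Oint K -> m != 0 ->
  exists r q : K, [/\ r \in @Oint K, q \in @Oint K, a = r + m * q
    & forall s : place R K, `|s r| <= `|s m| * basis_size b].
Proof.
move=> aO mO m0; case: hb => _ bspan _; have [c cE] := bspan (a / m).
pose q := \sum_j (Num.floor (c j))%:~R * b j.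
have qO : q \in @Oint K.
  by rewrite rpred_sum// => j _; rewrite rpredM ?rpred_int ?Oint_basis.
exists (a - m * q), q; split=> // [||s].
- by rewrite rpredB// rpredM.
- by rewrite subrK.
have -> : a - m * q = m * \sum_j (c j - (Num.floor (c j))%:~R) *: b j.
  have aE : a = m * (a / m) by rewrite mulrCA divff// mulr1.
  rewrite {1}aE -mulrBr cE /q -sumrB; congr (_ * _); apply: eq_bigr => j _.
  by rewrite scalerBl scaler_int mulrzl.
rewrite rmorphM normrM ler_wpM2l// rmorph_sum.
rewrite (eq_bigr (fun j => ratr (c j - (Num.floor (c j))%:~R) * s (b j))).
  rewrite -[leRHS]mul1r; apply: ler_basis_size => j.
  by rewrite -ratr_norm -(rmorph1 (ratr : {rmorphism rat -> R})) ler_rat floor_sub_norm.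
by move=> j _; rewrite -mulr_algl rmorphM /= alg_num_field fmorph_rat.
Qed.

Definition box_elt (H : nat) (z : {ffun 'I_#|{: place R K}| -> 'I_H}) : K :=
  \sum_j (z j)%:R * b j.

Lemma Oint_box_elt H (z : {ffun 'I_#|{: place R K}| -> 'I_H}) :
  box_elt z \in @Oint K.
Proof. by rewrite rpred_sum// => j _; rewrite rpredM ?rpred_nat ?Oint_basis. Qed.

Lemma box_eltB H (z w : {ffun 'I_#|{: place R K}| -> 'I_H}) (s : place R K) :
  s (box_elt z - box_elt w) = \sum_j ((z j)%:R - (w j)%:R) * s (b j).
Proof.
rewrite -sumrB rmorph_sum; apply: eq_bigr => j _.
by rewrite -mulrBl rmorphM rmorphB !rmorph_nat.
Qed.

(** The invertible place matrix makes [b] linearly independent. *)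
Lemma box_elt_inj H : injective (@box_elt H).
Proof.
case: hb => _ _ bV z w zw; pose c := \row_j ((z j)%:R - (w j)%:R : R).
have : c *m place_mx b = 0.
  apply/matrixP => i k; rewrite !mxE.
  have := box_eltB z w (enum_val k); rewrite zw subrr rmorph0 => {2}->.
  by apply: eq_bigr => j _; rewrite !mxE.
move/(congr1 (mulmxr (invmx (place_mx b)))); rewrite /= mulmxK// mul0mx.
move=> /matrixP c0; apply/ffunP => j; apply/val_inj => /=.
have := c0 0 j; rewrite !mxE => /eqP; rewrite subr_eq0 eqr_nat => /eqP.
by [].
Qed.

Lemma box_eltB_le H (z w : {ffun 'I_#|{: place R K}| -> 'I_H}) (s : place R K) :
  `|s (box_elt z - box_elt w)| <= H%:R * basis_size b.
Proof.
rewrite box_eltB; apply: ler_basis_size => j.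
rewrite ler_norml lerBlDr lerNl opprB lerBlDr.
by apply/andP; split; rewrite -natrD ler_nat (leq_trans (ltnW (ltn_ord _))) ?leq_addr.
Qed.

End IntegralBasis.

Lemma same_truncn (R : archiRealFieldType) (x y : R) :
  0 <= x -> 0 <= y -> Num.truncn x = Num.truncn y -> `|x - y| < 1.
Proof.
move=> /truncn_itv/andP[l1 r1] /truncn_itv/andP[l2 r2] xy.
move: l1 l2 r1 r2; rewrite xy -!natr1 => l1 l2 r1 r2.
by rewrite ltr_norml; apply/andP; split; lra.
Qed.

(** The code records the integer part of [s a + T] at each place. Elements with equal codes differ
    by an algebraic integer of absolute value below 1 everywhere, that is, by 0. *)
Lemma bounded_Oint_code (R : realType) (K : fieldExtType rat) (T : R) :
  totally_real R K -> exists (F : finType) (code : K -> F),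
    forall a a', a \in @Oint K -> a' \in @Oint K ->
    (forall s : place R K, `|s a| <= T) -> (forall s : place R K, `|s a'| <= T) ->
    code a = code a' -> a = a'.
Proof.
move=> hK; pose N := Num.truncn (T + T).
exists {ffun place R K -> 'I_N.+1}.
exists (fun a => [ffun s : place R K => inord (Num.truncn (s a + T))]).
move=> a a' aO aO' aT aT' /ffunP code.
apply/eqP; rewrite -subr_eq0; apply: contraT => aa'.
have [s] := integral_place_ge1 hK (rpredB aO aO') aa'.
have bd (x : K) : (forall s : place R K, `|s x| <= T) ->
    0 <= s x + T /\ (Num.truncn (s x + T) < N.+1)%N.
  move=> /(_ s); rewrite ler_norml => /andP[lo hi].
  rewrite -lerBlDr sub0r; split => //.
  by rewrite ltnS le_truncn// lerD2r.
have [a0 aN] := bd a aT; have [a0' aN'] := bd a' aT'.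
have := code s; rewrite !ffunE => /(congr1 val) /=; rewrite !inordK// => tE.
have := same_truncn a0 a0' tE; rewrite opprD addrACA subrr addr0 -rmorphB.
by rewrite ltNge => /negbTE ->.
Qed.

(** * Bounded representatives along the trajectory *)

(* Each of the [kappa ^ d + 1] points is translated by the [H ^ (m d)] vectors of
   a box of size [H ~ eps E], and the first coordinates, reduced modulo O_K, fall
   into [L ^ d = kappa ^ d * H ^ (m d)] cells of width [2 B / L <= eps E ^- m]. *)
Lemma simultaneous_pigeonhole (R : realType) (K : fieldExtType rat) (m : nat) (eps : R) :
  totally_real R K -> 0 < eps -> exists (J : nat) (E0 : R), 0 < E0 /\
  forall E, E0 <= E -> forall (x : 'I_m -> place R K -> R)
    (y0 : 'I_J -> place R K -> R) (y : 'I_J -> 'I_m -> place R K -> R),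
  exists (j j' : 'I_J) (q0 : K) (q : 'I_m -> K),
  [/\ q0 \in @Oint K, forall i, q i \in @Oint K,
      j != j' \/ exists i, q i != 0,
      forall s : place R K,
        `|y0 j s - y0 j' s + E ^+ m * (\sum_i s (q i) * x i s + s q0)| < eps
    & forall i (s : place R K), `|y j i s - y j' i s + E^-1 * s (q i)| < eps].
Proof.
move=> hK eps0; have [b hb] := integral_basis_exists hK.
pose B := basis_size b + 1.
have bB : basis_size b < B by rewrite ltrDl.
have B0 : 0 < B by rewrite ltr_wpDl// basis_size_ge0.
pose kappa := (Num.truncn (2 * B * (8 * B / eps) ^+ m / eps)).+1.
have kappaP : 2 * B * (8 * B / eps) ^+ m <= eps * kappa%:R.
  by rewrite [leRHS]mulrC -ler_pdivrMr// ltW// /kappa truncnS_gt.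
(* The threshold on [E] forces [eps * E / (4 * B) >= 2], hence [H >= 1] and [E <= 8 * B / eps * H],
   the estimate for which [kappa] is chosen. *)
exists (kappa ^ #|{: place R K}|).+1, (8 * B / eps); split; first by rewrite divr_gt0// mulr_gt0.
move=> E EE0 x y0 y.
have E_gt0 : 0 < E by apply: lt_le_trans EE0; rewrite divr_gt0// mulr_gt0.
(* The factor 4 splits the error: the box contributes at most [eps * E / 4], and so do the two
   roundings together. *)
pose H := Num.truncn (eps * E / (4 * B)).
have /truncn_itv/andP[Hle Hgt] : 0 <= eps * E / (4 * B).
  by rewrite divr_ge0// ?mulr_ge0// ltW.
rewrite -/H in Hle Hgt.
have E2 : 2 <= eps * E / (4 * B).
  rewrite ler_pdivlMr ?mulr_gt0//; move: EE0; rewrite ler_pdivrMr//; lra.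
have H0 : (0 < H)%N.
  rewrite -ltnS -(ltr_nat R); apply: lt_trans Hgt; lra.
have H1 : 1 <= H%:R :> R by rewrite ler1n.
have EH : E <= 8 * B / eps * H%:R.
  have : eps * E / (4 * B) <= 2 * H%:R by move: Hgt; rewrite -natr1; lra.
  rewrite ler_pdivrMr ?mulr_gt0// => h.
  by rewrite mulrAC ler_pdivlMr//; lra.
pose L := (kappa * H ^ m)%N.
have L0 : (0 < L)%N by rewrite muln_gt0 expn_gt0 H0.
have LR0 : 0 < L%:R :> R by rewrite ltr0n.
have EL : E ^+ m * (2 * B) <= eps * L%:R.
  rewrite /L natrM natrX mulrA; apply: le_trans (ler_wpM2r _ kappaP); last by rewrite exprn_ge0.
  rewrite [leLHS]mulrC -[leRHS]mulrA ler_wpM2l ?(mulr_ge0 _ (ltW B0))// -exprMn.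
  apply: lerXn2r EH; rewrite nnegrE ?ltW//.
  by rewrite mulr_gt0// ?divr_gt0 ?mulr_gt0// ltr0n.
have HB : H%:R * B <= eps * E / 4.
  by move: Hle; rewrite ler_pdivlMr ?mulr_gt0//; lra.
have B4 : 2 * B <= eps * E / 4.
  by move: E2; rewrite ler_pdivlMr ?mulr_gt0//; lra.
have /choice[r rP] (p : 'I_(kappa ^ #|{: place R K}|).+1 * 'I_m) :
    exists a : K, a \in @Oint K /\ forall s : place R K, `|E * y p.1 p.2 s + s a| <= basis_size b.
  by have [a ? ?] := basis_round hb (fun s => E * y p.1 p.2 s); exists a.
pose D := ('I_(kappa ^ #|{: place R K}|).+1 *
  {ffun 'I_m -> {ffun 'I_#|{: place R K}| -> 'I_H}})%type.
(* The part [r] cancels [E * y] up to a bounded error; the box part is what the pigeonhole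
   varies. *)
pose q (p : D) i : K := r (p.1, i) + box_elt b (p.2 i).
have qO p i : q p i \in @Oint K.
  by rewrite rpredD ?Oint_box_elt//; case: (rP (p.1, i)).
pose w (p : D) (s : place R K) : R := (E ^+ m)^-1 * y0 p.1 s + \sum_i s (q p i) * x i s.
have /choice[a aP] (p : D) :
    exists a : K, a \in @Oint K /\ forall s : place R K, `|w p s + s a| <= basis_size b.
  by have [a ? ?] := basis_round hb (w p); exists a.
(* The first coordinate, reduced modulo O_K by [a p] and so bounded by [basis_size b < B], is
   shifted and rescaled into the interval from 0 to [L]. *)
pose v p s := (w p s + s (a p) + B) * (L%:R / (2 * B)).
have v0 p s : 0 <= v p s.
  rewrite mulr_ge0 ?divr_ge0 ?mulr_ge0 ?ltW//.
  by have [_ /(_ s)] := aP p; rewrite ler_norml => /andP[]; lra.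
have vL p s : (Num.truncn (v p s) < L)%N.
  rewrite truncn_lt_nat// /v mulrA ltr_pdivrMr ?mulr_gt0// mulrC ltr_pM2l//.
  by have [_ /(_ s)] := aP p; rewrite ler_norml => /andP[]; lra.
pose cell (p : D) : {ffun place R K -> 'I_L} := [ffun s => Ordinal (vL p s)].
have /injectivePn[p [p' pp' /ffunP cpp']] : ~~ injectiveb cell.
  apply/negP => /injectiveP/leq_card; apply/negP; rewrite -ltnNge.
  rewrite card_prod !card_ffun !card_ord /L expnMn -!expnM (mulnC m) mulSn.
  by rewrite -[X in (X < _)%N]add0n ltn_add2r expn_gt0 H0.
exists p.1, p'.1, (a p - a p'), (fun i => q p i - q p' i); split.
- by rewrite rpredB//; case: (aP p); case: (aP p').
- by move=> i; rewrite rpredB//; apply: qO.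
(* If the two points coincide, their roundings [r] cancel, so distinct box elements give a nonzero
   difference. *)
- have [p1|] := eqVneq p.1 p'.1; [right|by left].
  apply: contrapT => /forallNP qq; move/eqP: pp'; apply.
  apply/eqP; rewrite [p]surjective_pairing [p']surjective_pairing p1 xpair_eqE eqxx/=.
  apply/eqP/ffunP => i; apply: (box_elt_inj hb); apply/eqP; rewrite -subr_eq0.
  have /negP := qq i; rewrite negbK /q p1 opprD addrACA subrr add0r.
  by [].
- move=> s; have := cpp' s; rewrite !ffunE => /(congr1 val) /= /(same_truncn (v0 p s) (v0 p' s)).
  rewrite /v -mulrBl normrM (gtr0_norm (_ : 0 < L%:R / (2 * B))) ?divr_gt0 ?mulr_gt0//.
  rewrite mulrA ltr_pdivrMr ?mulr_gt0// mul1r => h.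
  have Em0 : 0 < E ^+ m by rewrite exprn_gt0.
  rewrite (_ : _ + _ = E ^+ m * (w p s + s (a p) + B - (w p' s + s (a p') + B))); last first.
    rewrite /w rmorphB /=.
    under eq_bigr do rewrite rmorphB /= mulrBl.
    rewrite sumrB; field; exact: lt0r_neq0.
  rewrite normrM (gtr0_norm Em0) -(ltr_pM2r LR0) -mulrA.
  by apply: lt_le_trans EL; rewrite ltr_pM2l.
- move=> i s; rewrite (_ : _ + _ = E^-1 * ((E * y p.1 i s + s (r (p.1, i))) -
    (E * y p'.1 i s + s (r (p'.1, i))) + s (box_elt b (p.2 i) - box_elt b (p'.2 i)))); last first.
    rewrite /q !(rmorphB, rmorphD) /=; field; exact: lt0r_neq0.
  rewrite normrM gtr0_norm ?invr_gt0// ltr_pdivrMl//.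
  apply: le_lt_trans (ler_normD _ _) _.
  have [_ /(_ s) h1] := rP (p.1, i); have [_ /(_ s) h2] := rP (p'.1, i).
  have h3 := box_eltB_le b (p.2 i) (p'.2 i) s.
  have h4 := ler_normB (E * y p.1 i s + s (r (p.1, i))) (E * y p'.1 i s + s (r (p'.1, i))).
  have h5 : H%:R * basis_size b <= H%:R * B by rewrite ler_wpM2l// ltW.
  have h6 : 0 < eps * E by rewrite mulr_gt0.
  move: h1 h2 h3 h4 h5 => /=.
  lra.
Qed.
(** The component of g_t u_x at a single place, multiplied out, with [E] for e^t. *)
Definition gu_real (R : realType) (m : nat) (E : R) (x : 'rV[R]_m) : 'M[R]_(1 + m) :=
  block_mx (E ^+ m)%:M (E ^+ m *: x) 0 (E^-1)%:M.

Lemma det_gu_real (R : realType) (m : nat) (E : R) (x : 'rV[R]_m) :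
  E != 0 -> \det (gu_real E x) = 1.
Proof.
by move=> E0; rewrite det_ublock !det_scalar expr1 -exprMn divff// expr1n.
Qed.

Lemma mul_gu_real (R : realType) (m : nat) (E : R) (x : 'rV[R]_m)
    (a : R) (u : 'cV[R]_m) :
  gu_real E x *m col_mx a%:M u =
    col_mx (E ^+ m * (\sum_j u j 0 * x 0 j + a))%:M (E^-1 *: u).
Proof.
rewrite mul_block_col mul0mx add0r !mul_scalar_mx; congr col_mx; apply/matrixP => i j.
rewrite !ord1 -scalemxAl !mxE /= !mulr1n addrC mulrDr; congr (_ * _ + _).
by apply: eq_bigr => k _; rewrite mulrC.
Qed.

Lemma lattice_pigeonhole (R : realType) (K : fieldExtType rat) (m : nat) (eps : R) :
  totally_real R K -> 0 < eps -> exists (J : nat) (E0 : R), 0 < E0 /\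
  forall E, E0 <= E -> forall (x : place R K -> 'rV[R]_m)
    (y : 'I_J -> place R K -> 'cV[R]_(1 + m)),
  exists (j j' : 'I_J) (v : 'cV[K]_(1 + m)),
  [/\ forall i, v i 0 \in @Oint K, j != j' \/ v != 0
    & forall s i, `|(y j s - y j' s + gu_real E (x s) *m map_mx s v) i 0| < eps].
Proof.
move=> hK eps0; have [J [E0 [E00 h]]] := simultaneous_pigeonhole m hK eps0.
exists J, E0; split=> // E EE0 x y.
have [j [j' [q0 [q [q0O qO jq h0 h1]]]]] := h E EE0 (fun i s => x s 0 i)
  (fun j s => y j s (lshift m 0) 0) (fun j i s => y j s (rshift 1 i) 0).
exists j, j', (col_mx q0%:M (\col_i q i)); split.
- move=> i; case: (split_ordP i) => k ->.
    by rewrite col_mxEu !ord1 mxE mulr1n.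
  by rewrite col_mxEd mxE.
- case: jq => [|[i qi]]; [by left|right].
  apply: contraNneq qi => /matrixP/(_ (rshift 1 i) 0).
  by rewrite col_mxEd !mxE => ->.
- move=> s i; rewrite map_col_mx map_scalar_mx mul_gu_real.
  case: (split_ordP i) => k ->; rewrite mxE.
    rewrite col_mxEu !ord1 !mxE /= mulr1n.
    by under eq_bigr do rewrite !mxE; exact: h0.
  by rewrite col_mxEd !mxE; exact: h1.
Qed.

(** If [v *m A = 0] and [v 0 j] is an entry of largest absolute value, then [v 0 j * k j] is a sum
    of [n] terms, each at most [eps * |v 0 j|] in absolute value, which is too small since
    [|k j| >= 1]. *)
Lemma diagonally_dominant_unitmx (R : realFieldType) (n : nat) (A : 'M[R]_n)
    (k : 'I_n -> R) (eps : R) :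
  (forall j, 1 <= `|k j|) -> (forall i j, `|A i j + k j *+ (i == j)| <= eps) ->
  n%:R * eps < 1 -> A \in unitmx.
Proof.
move=> k1 Ak neps; rewrite unitmxE unitfE; apply/det0P => -[v v0 vA].
have /rV0Pn[j0 vj0] := v0.
have [j _ jmax] := @arg_maxP _ _ _ j0 xpredT (fun j => `|v 0 j|) isT.
have vj : 0 < `|v 0 j|.
  by apply: lt_le_trans (jmax j0 isT); rewrite normr_gt0.
have : `|v 0 j| <= n%:R * eps * `|v 0 j|.
  apply: le_trans (_ : `|v 0 j * k j| <= _); first by rewrite normrM ler_peMr.
  rewrite (_ : v 0 j * k j = \sum_i v 0 i * (A i j + k j *+ (i == j))).
    apply: le_trans (ler_norm_sum _ _ _) _.
    apply: le_trans (_ : \sum_(i < n) `|v 0 j| * eps <= _).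
      by apply: ler_sum => i _; rewrite normrM ler_pM//; apply: jmax.
    by rewrite sumr_const card_ord -[leLHS]mulr_natl (mulrC _ eps) mulrA.
  under eq_bigr do rewrite mulrDr.
  rewrite big_split /=; move/matrixP/(_ 0 j): vA; rewrite !mxE => ->; rewrite add0r.
  rewrite (bigD1 j)//= eqxx mulr1n big1 ?addr0// => i /negbTE ->.
  by rewrite mulr0n mulr0.
by rewrite leNgt gtr_pMl// neps.
Qed.

Lemma ler_norm_mulmx (R : realFieldType) p n q (A : 'M[R]_(p, n)) (B : 'M[R]_(n, q))
    (a b : R) :
  (forall i j, `|A i j| <= a) -> (forall i j, `|B i j| <= b) ->
  forall i j, `|(A *m B) i j| <= n%:R * (a * b).
Proof.
move=> Aa Bb i j; rewrite mxE; apply: le_trans (ler_norm_sum _ _ _) _.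
apply: le_trans (_ : \sum_(k < n) a * b <= _).
  by apply: ler_sum => k _; rewrite normrM ler_pM.
by rewrite sumr_const card_ord mulr_natl.
Qed.

Lemma ler_norm_det (R : realFieldType) n (A : 'M[R]_n) (a : R) :
  (forall i j, `|A i j| <= a) -> `|\det A| <= n`!%:R * a ^+ n.
Proof.
move=> Aa; apply: le_trans (ler_norm_sum _ _ _) _.
apply: le_trans (_ : \sum_(s : 'S_n) a ^+ n <= _).
  apply: ler_sum => s _; rewrite normrM normrX normrN1 expr1n mul1r normr_prod.
  apply: le_trans (_ : \prod_(i < n) a <= _); last by rewrite prodr_const card_ord.
  by apply: ler_prod => i _; rewrite normr_ge0 Aa.
by rewrite sumr_const card_Sn mulr_natl.
Qed.

(* The coset of [w] under left multiplication by SL_n(O_K) is determined by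
   [\det w] and by [w] modulo [\det w]: if [w = w' + (\det w) E] and
   [\det w = \det w'], then [w w'^-1 = 1 + E \adj w']. *)
Lemma finite_det_classes (R : realType) (K : fieldExtType rat) (n : nat) (T : R) :
  totally_real R K -> exists2 Rad : R, 0 <= Rad & forall w : 'M[K]_n,
    (forall i j, w i j \in @Oint K) -> \det w != 0 ->
    (forall s : place R K, `|s (\det w)| <= T) ->
  exists2 u : 'M[K]_n, @SL_OK K n (w *m u) &
    forall (s : place R K) i j, `|s (u i j)| <= Rad.
Proof.
move=> hK; have [b hb] := integral_basis_exists hK.
(* One bound for both the determinants and the remainders modulo them; [|T|] guards against a
   negative [T]. *)
have [F [code codeP]] := bounded_Oint_code (`|T| * (basis_size b + 1)) hK.
have b0 := basis_size_ge0 b.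
pose P (w : 'M[K]_n) := [/\ forall i j, w i j \in @Oint K, \det w != 0 &
  forall s : place R K, `|s (\det w)| <= T].
have /choice[res resP] (wij : 'M[K]_n * 'I_n * 'I_n) :
    exists rq : K * K, P wij.1.1 ->
    [/\ rq.1 \in @Oint K, rq.2 \in @Oint K,
      wij.1.1 wij.1.2 wij.2 = rq.1 + \det wij.1.1 * rq.2 &
      forall s : place R K, `|s rq.1| <= `|s (\det wij.1.1)| * basis_size b].
  have [[wO w0 _]|nP] := pselect (P wij.1.1); last by exists (0, 0).
  have [r [q h]] := basis_residue hb (wO wij.1.2 wij.2) (Oint_det wO) w0.
  by exists (r, q).
pose class (w : 'M[K]_n) : F * {ffun 'I_n * 'I_n -> F} :=
  (code (\det w), [ffun ij => code (res (w, ij.1, ij.2)).1]).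
(* One representative per class, with default 0 for the classes that no admissible matrix attains.
   As there are finitely many classes, the inverses of the representatives have a common bound. *)
have /choice[rep repP] (c : F * {ffun 'I_n * 'I_n -> F}) :
    exists w' : 'M[K]_n, forall w, P w -> class w = c -> P w' /\ class w' = c.
  have [[w [Pw wc]]|nP] := pselect (exists w, P w /\ class w = c).
    by exists w => *.
  by exists 0 => w Pw wc; case: nP; exists w.
exists (\sum_c \sum_(s : place R K) \sum_i \sum_j `|s (invmx (rep c) i j)|).
  by do 4 (apply: sumr_ge0 => ? _).
move=> w wO w0 wT; have Pw : P w by [].
have [Pw' cw'] := repP _ w Pw erefl; set w' := rep _ in Pw' cw'.
have [wO' w0' wT'] := Pw'.
have w'U : w' \in unitmx by rewrite unitmxE unitfE.
have TT s (d : K) : `|s d| <= T -> `|s d : R| <= `|T| * (basis_size b + 1).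
  move=> dT; rewrite (le_trans dT)// (le_trans (ler_norm T))// ler_peMr//.
  by rewrite lerDr.
case: cw' => /esym/codeP dE /ffunP resE.
have {}dE : \det w = \det w'.
  by apply: dE; rewrite ?Oint_det// => s; apply: TT.
(* The difference of the quotients. The remainders being equal, [w = w' + \det w *: D], so that
   [w *m invmx w'] equals [1 + D *m \adj w'] and is integral. *)
pose D := \matrix_(i, j) ((res (w, i, j)).2 - (res (w', i, j)).2).
have DO i j : D i j \in @Oint K.
  by rewrite mxE rpredB//; [case: (resP (w, i, j))|case: (resP (w', i, j))].
have wE : w = w' + \det w *: D.
  apply/matrixP => i j; rewrite !mxE.
  have [r1 q1 e1 b1] := resP (w, i, j) Pw; have [r2 q2 e2 b2] := resP (w', i, j) Pw'.
  have rb w'' (s : place R K) (d : K) : P w'' ->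
      `|s d| <= `|s (\det w'')| * basis_size b -> `|s d| <= `|T| * (basis_size b + 1).
    move=> [_ _ /(_ s) h] /le_trans; apply; apply: ler_pM => //.
      by rewrite (le_trans h)// ler_norm.
    by rewrite lerDl.
  have rE : (res (w, i, j)).1 = (res (w', i, j)).1.
    apply: codeP => //; last by have := resE (i, j); rewrite !ffunE.
      by move=> s; apply: rb (b1 s).
    by move=> s; apply: rb (b2 s).
  move: e1 e2 => /= -> ->; rewrite rE -dE -addrA -mulrDr; congr (_ + _ * _).
  by rewrite addrC subrK.
exists (invmx w').
  split; last by rewrite det_mulmx det_inv dE mulfV.
  rewrite {1}wE mulmxDl mulmxV// -scalemxAl /invmx w'U -scalemxAr scalerA dE mulfV// scale1r.
  move=> i j; apply/OintP; rewrite mxE rpredD//; first by rewrite mxE rpred_nat.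
  by apply: Oint_mulmx => //; apply: Oint_adj.
move=> s i j; rewrite (bigD1 (class w))//= (bigD1 s)//= (bigD1 i)//= (bigD1 j)//=.
by rewrite -!addrA lerDl !addr_ge0 ?sumr_ge0// => *; rewrite ?sumr_ge0// => *;
  rewrite ?sumr_ge0// => *; rewrite ?sumr_ge0.
Qed.
Lemma natr_dist_ge1 (R : realDomainType) (j k : nat) :
  j != k -> 1 <= `|j%:R - k%:R : R|.
Proof.
rewrite neq_ltn; wlog jk : j k / (j < k)%N => [wlg /orP[] jk|_].
- by apply: wlg; rewrite ?jk.
- by rewrite distrC; apply: wlg; rewrite ?jk.
- by rewrite distrC ler_normr lerBrDr addrC natr1 ler_nat jk.
Qed.

(** Neither [E0] nor [Rad] depends on [E] or [x], so the second alternative places the trajectory in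
    a fixed compact set. *)
Lemma bounded_representative (R : realType) (K : fieldExtType rat) (m : nat) (eps : R) :
  totally_real R K -> 0 < eps -> (1 + m)%:R * eps < 1 ->
  exists E0 Rad : R, 0 < E0 /\ forall E, E0 <= E -> forall x : place R K -> 'rV[R]_m,
    (exists v : 'cV[K]_(1 + m), [/\ v != 0, forall i, v i 0 \in @Oint K &
       forall s i, `|(gu_real E (x s) *m map_mx s v) i 0| < eps]) \/
    (exists2 gamma : 'M[K]_(1 + m), @SL_OK K (1 + m) gamma &
       forall s i j, `|(gu_real E (x s) *m map_mx s gamma) i j| <= Rad).
Proof.
move=> hK eps0 neps; have [J [E0 [E00 h]]] := lattice_pigeonhole m hK eps0.
pose n := (1 + m)%N.
have [Rad Rad0 hRad] := finite_det_classes n (n`!%:R * (J%:R + eps) ^+ n) hK.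
exists E0, (n%:R * ((J%:R + eps) * Rad)); split=> // E EE0 x.
have E_neq0 : E != 0 by rewrite gt_eqF// (lt_le_trans E00).
have [|noshort] := pselect (exists v : 'cV[K]_(1 + m), [/\ v != 0,
  forall i, v i 0 \in @Oint K &
  forall s i, `|(gu_real E (x s) *m map_mx s v) i 0| < eps]); first by left.
right.
have /choice[vk vkP] (i : 'I_n) : exists vk : 'cV[K]_n * R,
    [/\ forall k, vk.1 k 0 \in @Oint K, 1 <= `|vk.2|, `|vk.2| <= J%:R &
    forall (s : place R K) k, `|(gu_real E (x s) *m map_mx s vk.1) k 0 + vk.2 *+ (k == i)| < eps].
  have [j [j' [v [vO jv vs]]]] := h E EE0 x (fun j _ => j%:R *: delta_mx i 0).
  exists (v, j%:R - j'%:R); split=> //=.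
  (* With [j = j'] the vector [v] would be nonzero and short, which [noshort] excludes. *)
  - have jj' : j != j'.
      apply/eqP => jj'; case: jv => [|v0]; first by rewrite jj' eqxx.
      apply: noshort; exists v; split=> // s k; have := vs s k.
      by rewrite jj' subrr add0r.
    exact: natr_dist_ge1.
  - rewrite ler_norml lerBlDr lerNl opprB lerBlDr; apply/andP; split; rewrite -natrD ler_nat;
      by rewrite (leq_trans (ltnW (ltn_ord _))) ?leq_addr.
  - move=> s k; have := vs s k; rewrite -scalerBl !mxE eqxx andbT addrC.
    by rewrite mulr_natr.
pose w : 'M[K]_n := \matrix_(k, i) (vk i).1 k 0.
have wO k i : w k i \in @Oint K by rewrite mxE; case: (vkP i).
have gw s k i : (gu_real E (x s) *m map_mx s w) k i =
    (gu_real E (x s) *m map_mx s (vk i).1) k 0.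
  by rewrite !mxE; apply: eq_bigr => l _; rewrite !mxE.
have det_gw (s : place R K) : \det (gu_real E (x s) *m map_mx s w) = s (\det w).
  by rewrite det_mulmx det_gu_real// mul1r det_map_mx.
have gw_le s k i : `|(gu_real E (x s) *m map_mx s w) k i| <= J%:R + eps.
  have [_ _ kJ /(_ s k)] := vkP i; rewrite -gw => h1.
  have := ler_normB ((gu_real E (x s) *m map_mx s w) k i + (vk i).2 *+ (k == i)) ((vk i).2 *+ (k == i)).
  rewrite addrK => /le_trans; apply; rewrite addrC lerD ?(ltW h1)//.
  by case: (k == i); rewrite ?mulr1n// mulr0n normr0.
(* Without places the bound is vacuous and the identity serves; otherwise [\det w] can be tested
   against 0 at some place. *)
have [s0|noplace] := pselect (inhabited (place R K)); last first.
  exists 1%:M => [|s]; last by exfalso; apply: noplace; exists.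
  by split=> [i j|]; [apply/OintP; rewrite mxE rpred_nat|exact: det1].
have w0 : \det w != 0.
  case: s0 => s; rewrite -(fmorph_eq0 s) -det_gw -unitfE -unitmxE.
  apply: (@diagonally_dominant_unitmx _ _ _ (fun i => (vk i).2) eps) => // [i|k i].
    by case: (vkP i).
  by rewrite gw; case: (vkP i) => _ _ _ /(_ s k)/ltW.
have [|u uSL uRad] := hRad w wO w0.
  by move=> s; rewrite -det_gw; apply: ler_norm_det.
exists (w *m u) => // s i j; rewrite map_mxM mulmxA; apply: ler_norm_mulmx => k l; first exact: gw_le.
by rewrite mxE; apply: uRad.
Qed.
(** * Topology of SL(K_S) and of the homogeneous space *)

Section PlaceEval.
Variables (R : realType) (K : fieldExtType rat) (s : place R K).

(** Naming the projection gives it a ring morphism structure, so that matrix identities over K_S are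
    read off place by place with [map_mx]. *)
Definition place_eval (a : KS R K) : R := a s.

Fact place_eval_zmod : zmod_morphism place_eval. Proof. by []. Qed.

Fact place_eval_monoid : monoid_morphism place_eval. Proof. by []. Qed.

HB.instance Definition _ :=
  GRing.isZmodMorphism.Build (KS R K) R place_eval place_eval_zmod.
HB.instance Definition _ :=
  GRing.isMonoidMorphism.Build (KS R K) R place_eval place_eval_monoid.

Lemma map_place_eval_diag p n (A : 'M[K]_(p, n)) :
  map_mx place_eval (map_mx (@diag_emb R K) A) = map_mx s A.
Proof. by apply/matrixP => i j; rewrite !mxE. Qed.

Lemma place_eval_trajectory m (x : 'rV[KS R K]_m) (t : R) :
  map_mx place_eval (@g_mx R K m t *m u_mx x) =
  gu_real (expR t) (map_mx place_eval x).
Proof.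
rewrite map_mxM !map_block_mx !map_mx0 !map_scalar_mx rmorph1.
rewrite mulmx_block !mulmx1 !mul0mx !mulmx0 !addr0 add0r mul_scalar_mx.
by rewrite /place_eval /= expRM_natl expRN.
Qed.

End PlaceEval.

Lemma cvg_KS (R : realType) (K : fieldExtType rat) (F : set_system (KS R K))
    (a : KS R K) :
  Filter F -> (forall s, (fun b : KS R K => b s) @ F --> a s) -> F --> a.
Proof.
move=> FF Fa; apply/cvg_sup => s A [B [[C oC <-] Ca] sBA].
by apply: filterS sBA _; apply: Fa; apply: open_nbhs_nbhs.
Qed.

Lemma place_eval_continuous (R : realType) (K : fieldExtType rat) (s : place R K) :
  continuous (@place_eval R K s : KS R K -> R).
Proof. exact: (@proj_continuous (place R K) (fun=> R) s). Qed.

Lemma cvg_KS_mx (R : realType) (K : fieldExtType rat) p n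
    (F : set_system 'M[KS R K]_(p, n)) (M : 'M[KS R K]_(p, n)) :
  Filter F -> (forall i j s, (fun X : 'M[KS R K]_(p, n) => X i j s) @ F --> M i j s) ->
  F --> M.
Proof.
move=> FF FM A [P MP sPA]; apply: filterS sPA _.
suff : F [set X : 'M[KS R K]_(p, n) | forall i j, P i j (X i j)] by [].
apply: filter_forall => i; apply: filter_forall => j.
have : (fun X : 'M[KS R K]_(p, n) => X i j) @ F --> M i j.
  by apply: cvg_KS => s; apply: FM.
by apply; apply: MP.
Qed.

(** Finiteness of the set of places makes a uniform ball a neighbourhood in the product topology. *)
Lemma nbhs_KS_mx (R : realType) (K : fieldExtType rat) p n (M : 'M[KS R K]_(p, n))
    (rho : R) : 0 < rho ->
  nbhs M [set X : 'M[KS R K]_(p, n) | forall i j s, `|X i j s - M i j s| < rho].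
Proof.
move=> rho0.
exists (fun i j => [set a : KS R K | forall s, `|a s - M i j s| < rho]); last by [].
move=> i j /=.
suff : nbhs (M i j) [set a : KS R K | forall s, `|a s - M i j s| < rho] by [].
apply: (@filter_forall _ (place R K : finType)
  (fun s => [set a : KS R K | `|a s - M i j s| < rho]) _ (nbhs_filter _)) => s.
have /cvgrPdist_lt/(_ _ rho0) := @place_eval_continuous R K s (M i j); apply: filterS => a.
by rewrite /place_eval /= distrC.
Qed.
Lemma entry_continuous (R : realType) (K : fieldExtType rat) p n i j (s : place R K) :
  continuous ((fun M => M i j s) : 'M[KS R K]_(p, n) -> R).
Proof.
move=> M; have FM : Filter (nbhs M) := nbhs_filter M.
apply/cvgrPdist_lt => e e0; apply: filterS (nbhs_KS_mx M e0) => X /(_ i j s).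
by rewrite distrC.
Qed.

Lemma det_place_continuous (R : realType) (K : fieldExtType rat) n (s : place R K) :
  continuous ((fun M => (\det M : KS R K) s) : 'M[KS R K]_n -> R).
Proof.
have -> : (fun M : 'M[KS R K]_n => (\det M : KS R K) s) =
    (fun M => \sum_(p : 'S_n) (-1) ^+ p * \prod_i M i (p i) s).
  apply/funext => M; rewrite -[LHS]/(place_eval s (\det M)) -det_map_mx.
  by apply: eq_bigr => p _; congr (_ * _); apply: eq_bigr => i _; rewrite mxE.
apply: continuous_big => [|p _]; first exact: add_continuous.
move=> M; have FM : Filter (nbhs M) := nbhs_filter M.
apply: cvgM; first exact: cvg_cst.
apply: (@continuous_big R _ *%R 1 xpredT _ _ _
  (fun i (M : 'M[KS R K]_n) => M i (p i) s)) => [|i _]; first exact: mul_continuous.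
exact: entry_continuous.
Qed.

(** The box is the continuous image of a product of segments, indexed by entries and places, to
    which Tychonoff applies. *)
Lemma compact_KS_box (R : realType) (K : fieldExtType rat) p n (rad : R) :
  compact [set M : 'M[KS R K]_(p, n) | forall s i j, `|M i j s| <= rad].
Proof.
pose I : finType := ('I_p * 'I_n * place R K)%type.
pose T := prod_topology (fun _ : I => R).
pose mx (f : T) : 'M[KS R K]_(p, n) :=
  \matrix_(i, j) ((fun s => f (i, j, s)) : KS R K).
have mx_cont : continuous mx.
  move=> f; have Ff : Filter (nbhs f) := nbhs_filter f.
  suff : fmap mx (nbhs f) --> mx f by [].
  apply: cvg_KS_mx => i j s.
  have -> : mx f i j s = f (i, j, s) by rewrite mxE.
  move=> A /(@proj_continuous I (fun=> R) (i, j, s) f); apply: (@filterS _ _ Ff) => g /=.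
  by rewrite mxE.
have := @tychonoff I (fun=> R) (fun=> [set` `[- rad, rad]]) (fun=> @segment_compact _ _ _).
move=> /(continuous_compact (continuous_subspaceT mx_cont)).
congr compact; apply/seteqP; split => [_ [f fr <-] s i j|M Mr].
  by have := fr (i, j, s); rewrite mxE /= in_itv /= ler_norml.
exists (fun ijs => M ijs.1.1 ijs.1.2 ijs.2) => [ijs|].
  by rewrite /= in_itv /= -ler_norml.
by apply/matrixP => i j; rewrite mxE.
Qed.

(** A filter on the subtype is pushed forward to [T]; its cluster point lies in [A] and hence lifts
    back. *)
Lemma compact_set_type (T : topologicalType) (A : set T) (B : set T) :
  compact (A `&` B) -> compact (set_val @^-1` B : set (set_type A)).
Proof.
move=> AB F FF FB.
have FAB : F (set_val @^-1` (A `&` B)).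
  by apply: filterS FB => g gB; split=> //; apply: set_valP.
have := AB (set_val @ F) (fmap_proper_filter _ FF) FAB; move=> [M [[AM BM] cM]].
exists (exist _ M (mem_set AM)); split=> // C D FC [E [[W oW <-] WM] sED].
have FC' : F (set_val @^-1` (set_val @` C)).
  by apply: filterS FC => g Cg; exists g.
have [_ [[g Cg <-] Og]] := cM _ W FC' (open_nbhs_nbhs (conj oW WM)).
by exists g; split=> //; apply: sED.
Qed.

Lemma compact_SL_box (R : realType) (K : fieldExtType rat) n (rad : R) :
  compact [set g : SL_KS R K n | forall s i j, `|(val g : 'M[KS R K]_n) i j s| <= rad].
Proof.
apply: (@compact_set_type _ (SL_KS R K n) [set M | forall s i j, `|M i j s| <= rad]).
rewrite setIC; apply: compact_closedI; first exact: compact_KS_box.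
have -> : SL_KS R K n = \bigcap_(s in [set: place R K])
    ((fun M : 'M[KS R K]_n => (\det M : KS R K) s) @^-1` [set 1]).
  apply/seteqP; split => [M /= M1 s _ /=|M M1]; first by rewrite M1.
  by apply/funext => s; apply: M1.
apply: closed_bigI => s _; apply: preimage_closed => [M _|]; first exact: det_place_continuous.
exact: closed_eq.
Qed.
Lemma left_coset_mem (R : realType) (K : fieldExtType rat) n (g : 'M[KS R K]_n) :
  left_coset g g.
Proof.
exists 1%:M; last by rewrite map_mx1 mulmx1.
by split=> [i j|]; [apply/OintP; rewrite mxE rpred_nat|exact: det1].
Qed.

(** The inverse of [gamma] is its adjugate, which again has entries in O_K. *)
Lemma left_coset_mul (R : realType) (K : fieldExtType rat) n (g : 'M[KS R K]_n)
    (gamma : 'M[K]_n) :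
  SL_OK K n gamma -> left_coset (g *m map_mx (@diag_emb R K) gamma) = left_coset g.
Proof.
move=> [gO g1]; apply/seteqP; split=> _ [d [dO d1] <-].
  exists (gamma *m d); last by rewrite map_mxM mulmxA.
  split; last by rewrite det_mulmx g1 d1 mulr1.
  by move=> i j; apply/OintP/Oint_mulmx => k l; apply/OintP.
exists (\adj gamma *m d).
  split=> [i j|].
    apply/OintP/Oint_mulmx => k l; last exact/OintP.
    by apply: Oint_adj => ? ?; apply/OintP.
  rewrite det_mulmx d1 mulr1 -[LHS]mul1r -{1}g1 -det_mulmx mul_mx_adj g1.
  exact: det1.
by rewrite -mulmxA -map_mxM mulmxA mul_mx_adj g1 mul1mx.
Qed.

Local Open Scope quotient_scope.

Lemma pi_SL_eqP (R : realType) (K : fieldExtType rat) n (g h : SL_KS R K n) :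
  \pi_(homogeneous_space R K n) g = \pi_(homogeneous_space R K n) h <->
  left_coset (val g : 'M[KS R K]_n) = left_coset (val h : 'M[KS R K]_n).
Proof.
split=> [gh|gh]; last by apply/eqquotP/asboolP.
have eP := @eqquotP _ (same_coset_equiv R K n) {eq_quot (same_coset_equiv R K n)} g h.
by have /asboolP := introT eP gh.
Qed.

(** * Lattices without short vectors *)

(** The margin [eta'], uniform in [v], says that the infimum of the sup norms of nonzero lattice
    vectors exceeds [eta]; this is what makes the condition open. *)
Definition lattice_min_gt (R : realType) (K : fieldExtType rat) n (eta : R)
    (g : 'M[KS R K]_n) : Prop :=
  exists2 eta', eta < eta' & forall v : 'cV[K]_n, v != 0 ->
    (forall i, v i 0 \in @Oint K) ->
    exists (s : place R K) i,
      eta' <= `|(map_mx (place_eval s) g *m map_mx s v) i 0|.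

Lemma lattice_min_gt_coset (R : realType) (K : fieldExtType rat) n (eta : R)
    (g h : 'M[KS R K]_n) :
  left_coset g = left_coset h -> lattice_min_gt eta g -> lattice_min_gt eta h.
Proof.
move=> gh [eta' ee gv].
have : left_coset g h by rewrite gh; apply: left_coset_mem.
move=> [gam [gamO gam1] <-]; exists eta' => // v v0 vO.
have [||s [i si]] := gv (gam *m v).
- apply: contraNneq v0 => /(congr1 (mulmx (invmx gam))); 
  rewrite mulmx0 mulKmx ?unitmxE ?gam1 ?unitr1//.
  by move=> ->.
- move=> i; apply: Oint_mulmx => k l; last by rewrite ord1.
  exact/OintP.
- by exists s, i; rewrite map_mxM map_place_eval_diag -mulmxA -map_mxM.
Qed.

Lemma KS_mx_bound (R : realType) (K : fieldExtType rat) p n (A : 'M[KS R K]_(p, n)) :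
  exists2 a : R, 0 < a & forall s i j, `|map_mx (@place_eval R K s) A i j| <= a.
Proof.
exists (1 + \sum_(s : place R K) \sum_i \sum_j `|map_mx (place_eval s) A i j|).
  by rewrite ltr_pwDl// sumr_ge0// => s _; rewrite sumr_ge0// => i _; rewrite sumr_ge0.
move=> s i j; rewrite (bigD1 s)//= (bigD1 i)//= (bigD1 j)//= ler_wpDl// -!addrA lerDl.
by rewrite !addr_ge0 ?sumr_ge0// => k _; rewrite ?sumr_ge0// => l _; rewrite sumr_ge0.
Qed.

Lemma mul_adj_place (R : realType) (K : fieldExtType rat) n (g : 'M[KS R K]_n)
    (s : place R K) (v : 'cV[R]_n) : \det g = 1 ->
  map_mx (place_eval s) (\adj g) *m (map_mx (place_eval s) g *m v) = v.
Proof.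
by move=> g1; rewrite mulmxA -map_mxM mul_adj_mx g1 map_scalar_mx rmorph1 mul1mx.
Qed.

(** Since [v = \adj g *m (g *m v)], a too small [g *m v] would make an entry of [v] smaller than 1
    at every place. The factor [n.+1] in [eta] gives the strict inequality. *)
Lemma lattice_min_gt_exists (R : realType) (K : fieldExtType rat) n (g : 'M[KS R K]_n) :
  totally_real R K -> \det g = 1 -> exists2 eta, 0 < eta & lattice_min_gt eta g.
Proof.
move=> hK g1; have [a a0 ga] := KS_mx_bound (\adj g).
pose eta := (n.+1%:R * a)^-1.
have eta0 : 0 < eta by rewrite invr_gt0 mulr_gt0.
exists (eta / 2); first by rewrite divr_gt0.
exists eta => [|v /cV0Pn[i vi0] vO]; first by rewrite ltr_pdivrMr// ltr_pMr// ltr1n.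
have [s vs] := @integral_place_ge1 R K _ hK (vO i) vi0; exists s.
apply: contrapT => /forallNP small; move: vs; apply/negP; rewrite -ltNge.
have -> : s (v i 0) = (map_mx s v) i 0 by rewrite mxE.
rewrite -(mul_adj_place s (map_mx s v) g1).
apply: le_lt_trans (ler_norm_mulmx (ga s) (_ : forall k l, _ <= eta) i 0) _.
  by move=> k l; rewrite ord1 leNgt; apply/negP => /ltW; apply: small.
rewrite mulrA /eta ltr_pdivrMr ?mulr_gt0// mul1r ltr_pM2r// ltr_nat.
exact: ltnSn.
Qed.

(** At the place where [g *m v] attains its sup norm [mu], the entries of [v] are at most
    [n * a * mu]. Replacing [g] by [X] thus changes the vector by a small fraction of [mu], so one
    [rho] suits all [v]. *)
Lemma lattice_min_gt_open (R : realType) (K : fieldExtType rat) n (g : 'M[KS R K]_n)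
    (eta : R) : \det g = 1 -> 0 <= eta -> lattice_min_gt eta g ->
  exists2 rho, 0 < rho & forall X : 'M[KS R K]_n,
    (forall i j s, `|X i j s - g i j s| < rho) -> lattice_min_gt eta X.
Proof.
move=> g1 eta0 [eta' ee gv]; have [a a0 ga] := KS_mx_bound (\adj g).
have eta'0 : 0 < eta' by apply: le_lt_trans ee.
pose c := n%:R * (n%:R * a) + 1.
have c0 : 0 < c by rewrite ltr_wpDl// !mulr_ge0// ltW.
(* With this radius [mu] shrinks at most by the factor [(eta + eta') / (2 * eta')], which leaves at
   least the midpoint of [eta] and [eta']. *)
exists ((eta' - eta) / (2 * eta' * c)).
  by rewrite divr_gt0 ?subr_gt0// !mulr_gt0.
set rho := _ / _ => X Xg; exists ((eta + eta') / 2); first lra.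
move=> v v0 vO; have [s0 [i0 si0]] := gv v v0 vO.
pose f (p : place R K * 'I_n) : R :=
  `|(map_mx (place_eval p.1) g *m map_mx p.1 v) p.2 0|.
have [[s k] _ fmax] := @arg_maxP _ _ _ (s0, i0) xpredT f isT.
set mu := f (s, k) in fmax.
have mu_ge : eta' <= mu by apply: le_trans si0 (fmax (s0, i0) isT).
exists s, k.
have vmu (i : 'I_n) (j : 'I_1) : `|(map_mx s v) i j| <= n%:R * (a * mu).
  rewrite -(mul_adj_place s (map_mx s v) g1).
  apply: ler_norm_mulmx => // l j'; rewrite ord1; exact: (fmax (s, l)).
have dX (i j : 'I_n) : `|(map_mx (place_eval s) (X - g)) i j| <= rho.
  by rewrite !mxE; apply/ltW/Xg.
have := ler_norm_mulmx dX vmu k 0.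
have -> : map_mx (place_eval s) (X - g) *m map_mx s v =
    map_mx (place_eval s) X *m map_mx s v - map_mx (place_eval s) g *m map_mx s v.
  by rewrite map_mxB mulmxBl.
rewrite mxE [X in _ + X]mxE.
set y := (_ *m _) k 0; set z := (_ *m _) k 0 => yz.
have muz : mu = `|z| by [].
rewrite muz in mu_ge yz.
have rE : rho * c = (eta' - eta) / (2 * eta').
  by rewrite /rho; field; rewrite !gt_eqF.
have h1 : n%:R * (rho * (n%:R * (a * `|z|))) <= `|z| * ((eta' - eta) / (2 * eta')).
  rewrite -rE (_ : n%:R * _ = `|z| * (rho * (n%:R * (n%:R * a)))); last by ring.
  by rewrite ler_wpM2l// ler_wpM2l ?lerDl// divr_ge0 ?mulr_ge0 ?subr_ge0 ?ltW.
have h2 : `|z| <= `|y - z| + `|y|.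
  by have := ler_normD (z - y) y; rewrite subrK distrC.
have h3 : eta' * ((eta + eta') / (2 * eta')) <= `|z| * ((eta + eta') / (2 * eta')).
  by apply: ler_wpM2r => //; apply: divr_ge0; lra.
have e1 : eta' * ((eta + eta') / (2 * eta')) = (eta + eta') / 2.
  by field; rewrite gt_eqF.
have e2 : `|z| * ((eta + eta') / (2 * eta')) = `|z| - `|z| * ((eta' - eta) / (2 * eta')).
  by field; rewrite gt_eqF.
by move: yz h1 h2 h3; rewrite e1 e2; lra.
Qed.

(** * Singularity and short vectors along the trajectory *)

Lemma norm_KS_ltP (R : realType) (K : fieldExtType rat) (a : KS R K) (c : R) :
  0 < c -> norm_KS a < c <-> forall s, `|a s| < c.
Proof.
move=> c0; split=> [/bigmax_ltP[_ ac] s|ac]; first exact: ac.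
by apply/bigmax_ltP; split.
Qed.

Lemma norm_KSm_leP (R : realType) (K : fieldExtType rat) m (x : 'rV[KS R K]_m) (c : R) :
  0 <= c -> norm_KSm x <= c <-> forall s j, `|x 0 j s| <= c.
Proof.
move=> c0; split=> [/bigmax_leP[_ xc] s j|xc].
  by have /bigmax_leP[_] := xc j isT; apply.
by apply/bigmax_leP; split=> // j _; apply/bigmax_leP; split.
Qed.

Lemma place_eval_form (R : realType) (K : fieldExtType rat) m (x : 'rV[KS R K]_m)
    (q : 'rV[K]_m) (q0 : K) (s : place R K) :
  (\sum_j diag_emb (q 0 j) * x 0 j + diag_emb q0 : KS R K) s =
  \sum_j (map_mx s q^T) j 0 * (map_mx (place_eval s) x) 0 j + s q0.
Proof.
rewrite -[LHS]/(place_eval s _) rmorphD rmorph_sum; congr (_ + _).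
by apply: eq_bigr => j _; rewrite rmorphM !mxE.
Qed.

Lemma singular_short (R : realType) (K : fieldExtType rat) m (x : 'rV[KS R K]_m)
    (eta : R) : singular x -> 0 < eta ->
  \forall t \near +oo, exists v : 'cV[K]_(1 + m),
    [/\ v != 0, forall i, v i 0 \in @Oint K & forall (s : place R K) i,
    `|(gu_real (expR t) (map_mx (place_eval s) x) *m map_mx s v) i 0| <= eta].
Proof.
(* Take [c = eta^(m+1)] and [Q = eta * e^t]: then [c / Q^m = eta / e^(m t)], and both blocks are at
   most [eta] after rescaling. *)
move=> sing eta0; have [M [_ MP]] := sing (eta ^+ m.+1) (exprn_gt0 _ eta0).
exists (M / eta); split; first exact: num_real.
move=> t tM; have E0 : 0 < expR t := expR_gt0 t.
have QM : M < eta * expR t.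
  rewrite mulrC -ltr_pdivrMr// (lt_le_trans tM)//.
  by apply: le_trans (expR_ge1Dx t); rewrite lerDr.
have [q [q0 [qn0 [qO q0O] h0 h1]]] := MP _ QM.
have Q0 : 0 < eta * expR t by rewrite mulr_gt0.
exists (col_mx q0%:M q^T); split.
- apply: contraNneq qn0 => /matrixP v0; apply/eqP/rowP => j.
  by have := v0 (rshift 1 j) 0; rewrite col_mxEd !mxE.
- move=> i; case: (split_ordP i) => k ->.
    by rewrite col_mxEu !ord1 mxE mulr1n; apply/OintP.
  by rewrite col_mxEd mxE; apply/OintP.
- move=> s i; rewrite map_col_mx map_scalar_mx mul_gu_real.
  case: (split_ordP i) => k ->.
    rewrite col_mxEu !ord1 mxE mulr1n -place_eval_form normrM.
    have /norm_KS_ltP h : 0 < eta ^+ m.+1 / (eta * expR t) ^+ m.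
      by rewrite divr_gt0 ?exprn_gt0.
    have {h} := (h _ _).1 h0 s; rewrite ltr_pdivlMr ?exprn_gt0// exprMn exprS => h.
    have Em : 0 < expR t ^+ m by rewrite exprn_gt0.
    rewrite (gtr0_norm Em) -(ler_pM2r (exprn_gt0 m eta0)); apply: ltW.
    by rewrite mulrAC mulrC (mulrC (expR t ^+ m)).
  rewrite col_mxEd !mxE normrM gtr0_norm ?invr_gt0// ler_pdivrMl// mulrC.
  by have := (norm_KSm_leP _ (ltW Q0)).1 h1 s k; rewrite mxE.
Qed.

Theorem theorem4p2 (R : realType) (K : fieldExtType rat)
    (hK : totally_real R K) (m : nat) (hm : (1 <= m)%N) (x : 'rV[KS R K]_m) :
  singular x <-> divergent (trajectory x).
Proof.
split=> [sing C cC|div c c0].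
(* If the trajectory returns to [C] at arbitrarily large times, it clusters at some [z] in [C] along
   those times. A neighbourhood of [z] avoids vectors of norm at most [eta], whereas the trajectory
   eventually has such vectors. *)
- apply: contrapT => often.
  pose F : set_system R := within [set t | C (trajectory x t)] (nbhs +oo).
  have FF : ProperFilter F.
    apply: Build_ProperFilter_ex => B FB.
    apply: contrapT => /forallNP nB; apply: often.
    have {}FB : nbhs +oo [set t : R | C (trajectory x t) -> B t] := FB.
    by apply: filterS FB => t FBt /= Ct; apply: (nB t); apply: FBt.
  have FC : (trajectory x @ F) C by apply: withinT.
  have [z [Cz clz]] := cC _ (fmap_proper_filter _ FF) FC.
  pose g : SL_KS R K (1 + m) := repr z.
  have gz : \pi_(homogeneous_space R K (1 + m)) g = z := reprK z.
  have g1 : \det (val g : 'M[KS R K]_(1 + m)) = 1 := set_valP g.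
  have [eta eta0 gmin] := lattice_min_gt_exists hK g1.
  pose V : set (homogeneous_space R K (1 + m)) :=
    [set p | exists h : SL_KS R K (1 + m),
      \pi_(homogeneous_space R K (1 + m)) h = p /\ lattice_min_gt eta (val h)].
  have oV : open V.
    suff : open ((fun h : SL_KS R K (1 + m) => \pi_(homogeneous_space R K (1 + m)) h) @^-1` V) by [].
    rewrite openE => h [h' [/pi_SL_eqP hh' /(lattice_min_gt_coset hh') hmin]].
    have h1 : \det (val h : 'M[KS R K]_(1 + m)) = 1 := set_valP h.
    have [rho rho0 near_h] := lattice_min_gt_open h1 (ltW eta0) hmin.
    have := @initial_continuous _ _ (set_val : SL_KS R K (1 + m) -> _) h _ (nbhs_KS_mx (val h) rho0).
    by apply: (@filterS _ _ (nbhs_filter h)) => X Xh; exists X; split=> //; apply: near_h.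
  have zV : nbhs z V by apply: open_nbhs_nbhs; split=> //; exists g.
  pose short t := exists v : 'cV[K]_(1 + m),
    [/\ v != 0, forall i, v i 0 \in @Oint K & forall (s : place R K) i,
    `|(gu_real (expR t) (map_mx (place_eval s) x) *m map_mx s v) i 0| <= eta].
  have Fshort : (trajectory x @ F) (trajectory x @` short).
    rewrite /fmap /= /F /within /=.
    by apply: filterS (singular_short sing eta0) => t tshort _; exists t.
  have [_ [[t [v [v0 vO vs]] <-] [h [/pi_SL_eqP ht hmin]]]] := clz _ _ Fshort zV.
  have [eta' ee] := lattice_min_gt_coset ht hmin.
  move=> /(_ v v0 vO)[s [k le1]]; rewrite place_eval_trajectory in le1.
  by have := lt_le_trans ee (le_trans le1 (vs s k)); rewrite ltxx.
(* The three bounds give, in turn, [q != 0], [eps^(m+1) <= c], and the diagonal dominance behind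
   [bounded_representative]. *)
- pose eps := Num.min (Num.min 1 c) ((1 + m)%:R + 1)^-1.
  have n0 : 0 < (1 + m)%:R + 1 :> R by rewrite ltr_wpDl.
  have eps0 : 0 < eps by rewrite !lt_min ltr01 c0 invr_gt0.
  have eps1 : eps <= 1 by rewrite /eps !ge_min lexx.
  have epsc : eps ^+ m.+1 <= c.
    apply: le_trans (_ : eps <= _); last by rewrite /eps !ge_min lexx orbT.
    by rewrite exprS ler_piMr ?exprn_ile1// ltW.
  have neps : (1 + m)%:R * eps < 1.
    apply: le_lt_trans (_ : (1 + m)%:R * ((1 + m)%:R + 1)^-1 < _).
      by rewrite ler_wpM2l// /eps ge_min lexx orbT.
    by rewrite ltr_pdivrMr// mul1r ltrDl.
  have [E0 [rad [E00 hrad]]] := @bounded_representative R K m eps hK eps0 neps.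
  pose A := [set g : SL_KS R K (1 + m) |
    forall s i j, `|(val g : 'M[KS R K]_(1 + m)) i j s| <= rad].
  have cA : compact ((fun g : SL_KS R K (1 + m) => \pi_(homogeneous_space R K (1 + m)) g) @` A).
    apply: continuous_compact; last exact: compact_SL_box.
    by apply: continuous_subspaceT; apply: pi_continuous.
  have [M [_ MP]] := div _ cA.
  (* With [E = Q / eps], this makes [E] exceed [E0] and 1, and makes the time [ln E] exceed [M]. *)
  exists (eps * (expR M + E0 + 1)); split; first exact: num_real.
  move=> Q QM; pose E := Q / eps.
  have EM : expR M + E0 + 1 < E by rewrite ltr_pdivlMr// mulrC.
  have eM : 0 < expR M := expR_gt0 M.
  have E_gt0 : 0 < E by lra.
  have lnE : expR (ln E) = E by rewrite lnK// posrE.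
  have ME : M < ln E by rewrite -ltr_expR lnE; lra.
  have [|[v [v0 vO vs]]|[gam gamSL grad]] := hrad E _ (fun s => map_mx (place_eval s) x).
  + lra.
  + pose q0 := v (lshift m 0) 0; pose q : 'rV[K]_m := (dsubmx v)^T.
    have vE : v = col_mx q0%:M q^T.
      rewrite trmxK -[LHS]vsubmxK; congr col_mx.
      by apply/matrixP => i j; rewrite !ord1 !mxE eqxx mulr1n.
    have Q0 : 0 < Q by rewrite -(divfK (lt0r_neq0 eps0) Q) mulr_gt0.
    have Q_eps : Q = eps * E by rewrite mulrC divfK ?gt_eqF.
    have top (s : place R K) : `|E ^+ m * (\sum_j diag_emb (q 0 j) * x 0 j + diag_emb q0 : KS R K) s| < eps.
      have := vs s (lshift m 0); rewrite vE map_col_mx map_scalar_mx mul_gu_real.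
      by rewrite col_mxEu mxE mulr1n place_eval_form.
    have bot (s : place R K) j : `|E^-1 * s (q 0 j)| < eps.
      have := vs s (rshift 1 j); rewrite vE map_col_mx map_scalar_mx mul_gu_real.
      by rewrite col_mxEd !mxE.
    exists q, q0; split.
    (* If [q = 0], then [q0] is smaller than [eps <= 1] at every place, because [E^m >= 1]; hence
       [q0 = 0] and [v = 0]. *)
    * apply: contraNneq v0 => q_0; rewrite vE q_0 trmx0.
      suff -> : q0 = 0 by rewrite raddf0 col_mx0.
      apply: contrapT => /eqP q00.
      have [s] := @integral_place_ge1 R K q0 hK (vO _) q00; apply/negP; rewrite -ltNge.
      apply: lt_le_trans eps1; apply: le_lt_trans (top s).
      rewrite place_eval_form q_0 big1 ?add0r => [|j _]; last by rewrite !mxE rmorph0 mul0r.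
      rewrite normrM ler_peMl// gtr0_norm ?exprn_gt0// exprn_ege1//; lra.
    * by split=> [j|]; apply/OintP; rewrite ?mxE; apply: vO.
    * apply/norm_KS_ltP => [|s]; first by rewrite divr_gt0// exprn_gt0.
      have Em : 0 < E ^+ m by rewrite exprn_gt0.
      have := top s; rewrite normrM (gtr0_norm Em) => ts.
      rewrite ltr_pdivlMr ?exprn_gt0// Q_eps exprMn; apply: lt_le_trans epsc.
      by rewrite exprS mulrCA mulrC ltr_pM2r ?exprn_gt0// mulrC.
    * apply/norm_KSm_leP => [|s j]; first exact: ltW.
      have := bot s j; rewrite normrM gtr0_norm ?invr_gt0// ltr_pdivrMl// => /ltW.
      by rewrite [map_mx _ q 0 j]mxE Q_eps mulrC.
  (* A bounded representative of the coset at time [ln E > M] puts the trajectory in the compact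
     image of [A], against divergence. *)
  + exfalso; apply: (MP _ ME).
    have SLg : SL_KS R K (1 + m)
        (@g_mx R K m (ln E) *m u_mx x *m map_mx (@diag_emb R K) gam).
      rewrite /SL_KS /= det_mulmx (gu_SL x (ln E)) mul1r det_map_mx.
      by have [_ ->] := gamSL; rewrite rmorph1.
    exists (exist _ (@g_mx R K m (ln E) *m u_mx x *m map_mx (@diag_emb R K) gam)
        (mem_set SLg) : SL_KS R K (1 + m)).
      move=> s i j; have := grad s i j.
      by rewrite -[in X in X -> _]lnE -place_eval_trajectory -map_place_eval_diag -map_mxM mxE.
    apply/pi_SL_eqP; exact: left_coset_mul.
Qed.
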